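(* Let $\phi=(1+\sqrt5)/2$ be the golden mean and let $T_\phi:\mathbb R^2\to\mathbb R^2$ be defined by $T_\phi(x,y)=\big(x+1/\phi^2,\;y+x-1/(2\phi^3)\big)$. For every integer $M$ there exists an exchange of pieces $\mathcal R_M$ conjugate to $T_\phi$ such that $p_{\mathcal R_M}(k)=k+1$ for every integer $1\le k\le M$. That is, for every integer $n$, $p^{T_\phi}(n)=n+1$.
   Context: $\mu$ is Lebesgue measure on $\mathbb R^2$ and $\overline\mu$ is Lebesgue measure on $\mathbb R^2/\mathbb Z^2$. Let $T:\mathbb R^2\to\mathbb R^2$ be measurable, preserving $\mu$, and $\mu$-almost surely $\mathbb Z^2$-periodic, i.e. for $\mu$-a.e. $x$, $T(x+\mathbb Z^2)\subset T(x)+\mathbb Z^2$. Then $T$ induces a map $\overline T$ of $\mathbb R^2/\mathbb Z^2$, and $\overline{\mathcal T}=(\overline T,\mathbb R^2/\mathbb Z^2,\overline\mu)$. An exchange of $m$ pieces $\mathcal R=(R,D,\mu)$, where $D\subset\mathbb R^2$ and $R:D\to D$, is adapted to $T$ if: (1) the dynamical system it generates (the map $R$ on $D$ with the restriction of $\mu$) is equivalent in measure to $\overline{\mathcal T}$; (2) $D$ is the union of $m$ measurable pieces $D_1,\dots,D_m$ that are almost surely pairwise disjoint ($\mu(D_i\cap D_j)=0$ for $i\ne j$); (3) the set of $x\in D$ for which there is $y\in D$, $y\neq x$, with $x-y\in\mathbb Z^2$ has measure zero; (4) for every $x\in D$, $R(x)=T(x)-\mathbf n_i$ if $x\in D_i$,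 where $\mathbf n_i\in\mathbb Z^2$ depends only on $i$. The pieces need not be bounded. For $\mu$-a.e. $x\in D$ the coding $C(x)\in\{1,\dots,m\}^{\mathbb N}$ is the sequence whose $n$-th term is $i$ if $R^n(x)\in D_i$. $S_{\mathcal R}$ is the set of sequences so obtained, $\mu_{\mathcal R}$ is the push-forward of $\mu|_D$ by $C$, and $\mathcal S_{\mathcal R}$ is the symbolic system given by the shift on $(S_{\mathcal R},\mu_{\mathcal R})$. The language $\mathfrak L_{\mathcal R}$ is the set of all factors (blocks of consecutive letters) of elements of $S_{\mathcal R}$, and $p_{\mathcal R}(n)$ is the number of words of length $n$ in $\mathfrak L_{\mathcal R}$. The exchange $\mathcal R$ (adapted to $T$) is conjugate to $T$ if $\mathcal S_{\mathcal R}$ is conjugate in measure (measure-theoretically isomorphic) to $\overline{\mathcal T}$. When at least one exchange of pieces conjugate to $T$ exists, the complexity function associated to $T$ is $p^T(n)=\inf\{p_{\mathcal R}(n): \mathcal R \text{ an exchange of pieces conjugate to } T\}$ (the number of pieces $m$ being arbitrary). *)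

(* Defs.v *)
From HB Require Import structures.
From mathcomp Require Import all_boot all_order all_algebra generic_quotient.
From mathcomp Require Import all_classical all_reals all_analysis.
From mathcomp Require Import measurable_realfun.

Set Implicit Arguments.
Unset Strict Implicit.
Unset Printing Implicit Defensive.
Import Order.TTheory GRing.Theory Num.Theory.

Local Open Scope quotient_scope.
Local Open Scope classical_set_scope.
Local Open Scope ring_scope.

Notation plane R := (measurableTypeR R * measurableTypeR R)%type.

(* Lebesgue measure on the Borel sets of the plane. *)
Definition leb2 (R : realType) : {measure set (plane R) -> \bar R} :=
  (@lebesgue_measure R \x @lebesgue_measure R)%E.

Definition lebesgue_measurable (R : realType) : set (set (plane R)) :=
  completed_algebra_gen (leb2 R).

Definition Z2 (R : realType) : {pred plane R} :=
  [pred v | (v.1 \is a Num.int) && (v.2 \is a Num.int)].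

Section torus.
Variable R : realType.

Definition eqmodZ2 (x y : plane R) : bool := x - y \in @Z2 R.

Lemma eqmodZ2_refl : reflexive eqmodZ2.
Proof. by move=> x; rewrite /eqmodZ2 subrr inE /= !rpred0. Qed.

Lemma eqmodZ2_sym : symmetric eqmodZ2.
Proof. by move=> x y; rewrite /eqmodZ2 -opprB !inE /= !rpredN. Qed.

Lemma eqmodZ2_trans : transitive eqmodZ2.
Proof.
move=> y x z; rewrite /eqmodZ2 !inE /= => /andP[xy1 xy2] /andP[yz1 yz2].
by apply/andP; split; [rewrite -(subrKA y.1)|rewrite -(subrKA y.2)]; rewrite rpredD.
Qed.

Canonical eqmodZ2_equivRel :=
  EquivRel eqmodZ2 eqmodZ2_refl eqmodZ2_sym eqmodZ2_trans.

Definition torus := {eq_quot eqmodZ2}.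

HB.instance Definition _ := Choice.on torus.
HB.instance Definition _ := EqQuotient.on torus.
HB.instance Definition _ := isPointed.Build torus (\pi_torus 0).

Definition torus_measurable (A : set torus) : Prop :=
  @measurable _ (plane R) (\pi_torus @^-1` A).

Lemma torus_measurable0 : torus_measurable set0.
Proof. exact: measurable0. Qed.

Lemma torus_measurableC A : torus_measurable A -> torus_measurable (~` A).
Proof. exact: measurableC. Qed.

Lemma torus_measurable_bigcup (F : (set torus)^nat) :
  (forall i, torus_measurable (F i)) -> torus_measurable (\bigcup_i F i).
Proof. exact: bigcupT_measurable. Qed.

HB.instance Definition _ := @isMeasurable.Build default_measure_display torus
  torus_measurable torus_measurable0 torus_measurableC torus_measurable_bigcup.

(* [0, 1[ ^ 2 is a fundamental domain for the action of Z ^ 2. *)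
Definition torus_measure (A : set torus) : \bar R :=
  leb2 R ((`[0, 1[ `*` `[0, 1[) `&` \pi_torus @^-1` A).

(* When T (x + Z ^ 2) `<=` T x + Z ^ 2 for almost every x, the choice of the
   representative is irrelevant outside of a negligible set of the torus. *)
Definition induced_map (T : plane R -> plane R) (t : torus) : torus :=
  \pi_torus (T (repr t)).

End torus.

(* A and B are the actual spaces of the two systems, inside the ambient
   measurable types X and Y; they need not be measurable themselves, but the
   sets A' and B' of full measure between which the isomorphism holds are.
   For a Lebesgue measurable subset A of the plane, requiring A' to be a Borel
   set is not a restriction, as every Lebesgue measurable set contains a Borel
   set of the same measure. Similarly, the set of codings defined below contains
   a measurable set of full measure, as the image of a Borel set under a
   measurable map. *)
Definition isomorphic_in_measure (R : realType) d (X : measurableType d)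
    (mu : set X -> \bar R) (A : set X) (S : X -> X)
    d' (Y : measurableType d')
    (nu : set Y -> \bar R) (B : set Y) (T : Y -> Y) : Prop :=
  exists (A' : set X) (B' : set Y) (f : X -> Y) (g : Y -> X),
  [/\ [/\ measurable A', A' `<=` A, mu.-negligible (A `\` A') &
          set_fun A' A' S],
      [/\ measurable B', B' `<=` B, nu.-negligible (B `\` B') &
          set_fun B' B' T],
      [/\ set_fun A' B' f, set_fun B' A' g,
          forall x, A' x -> g (f x) = x & forall y, B' y -> f (g y) = y],
      [/\ measurable_fun A' f, measurable_fun B' g &
          forall E, measurable E -> E `<=` B' -> mu (A' `&` f @^-1` E) = nu E] &
      forall x, A' x -> f (S x) = T (f x)].

(* [emap] is only meaningful on [domain]. A system isomorphic to the torus needs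
   at least one piece, so the number of pieces is taken of the form
   [psize.+1]; this makes the alphabet a pointed type. *)
Record exchange (R : realType) := Exchange {
  psize : nat;
  domain : set (plane R);
  emap : plane R -> plane R;
  piece : 'I_psize.+1 -> set (plane R) }.

Arguments piece {R} e i.

Definition adapted (R : realType) (T : plane R -> plane R) (E : exchange R) :
    Prop :=
  set_fun (domain E) (domain E) (emap E) /\
  [/\ isomorphic_in_measure (leb2 R) (domain E) (emap E)
        (@torus_measure R) setT (induced_map T),
      [/\ domain E = \bigcup_i piece E i,
          forall i, lebesgue_measurable (piece E i) &
          forall i j, i != j ->
            (leb2 R).-negligible (piece E i `&` piece E j)],
      (leb2 R).-negligible
        [set x | domain E x /\
           exists y, [/\ domain E y, y != x & x - y \in @Z2 R]] &
      exists2 v : 'I_(psize E).+1 -> plane R, (forall i, v i \in @Z2 R) &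
        forall x i, domain E x -> piece E i x -> emap E x = T x - v i].

Section symbolic_system.
Variables (R : realType) (E : exchange R).

Definition letter := 'I_(psize E).+1.

HB.instance Definition _ := Finite.on letter.
HB.instance Definition _ := isPointed.Build letter ord0.

Definition cylinders : set_system (nat -> letter) :=
  [set C | exists n i, C = [set s | s n = i]].

Definition letter_seq := g_sigma_algebraType cylinders.

HB.instance Definition _ := Measurable.on letter_seq.

(* s is the coding of x; it is unique, and it exists as soon as no point of the
   orbit of x belongs to several pieces, that is, for almost every x. *)
Definition codes (x : plane R) (s : letter_seq) : Prop :=
  forall n i, piece E i (iter n (emap E) x) <-> s n = i.

Definition symbolic_space : set letter_seq :=
  [set s | exists2 x, domain E x & codes x s].

(* The outer measure evaluates the completed Lebesgue measure on the preimages
   under the coding, which are only Lebesgue measurable. *)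
Definition symbolic_measure (B : set letter_seq) : \bar R :=
  ((leb2 R)^*)%mu [set x | domain E x /\ exists2 s, codes x s & B s].

Definition shift (s : letter_seq) : letter_seq := fun n => s n.+1.

Definition language : set (seq letter) :=
  [set w | exists2 s, symbolic_space s &
     exists k, w = mkseq (fun j => s (k + j)%N) (size w)].

Definition complexity (n : nat) : nat :=
  #|[set w : n.-tuple letter | `[< language w >]]%SET|.

End symbolic_system.

Definition conjugate_to (R : realType) (T : plane R -> plane R)
    (E : exchange R) : Prop :=
  adapted T E /\
  isomorphic_in_measure (@symbolic_measure R E) (@symbolic_space R E)
    (@shift R E) (@torus_measure R) setT (induced_map T).

Definition map_complexity (R : realType) (T : plane R -> plane R) (n : nat) :
    \bar R :=
  ereal_inf [set ((complexity E n)%:R)%:E | E in conjugate_to T].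

Definition golden (R : realType) : R := (1 + Num.sqrt 5) / 2.

Definition Tphi (R : realType) (z : plane R) : plane R :=
  (z.1 + 1 / golden R ^+ 2, z.2 + z.1 - 1 / (2 * golden R ^+ 3)).

(* Main.v *)
Require Import Defs.
From mathcomp Require Import all_boot all_order all_algebra generic_quotient.
From mathcomp Require Import all_classical all_reals all_analysis.
From mathcomp Require Import measurable_realfun ring lra zify.

(** Write g = 1 / phi, so that T is the skew product
    (x, y) -> (x + g ^ 2, y + x - g ^ 3 / 2) over a rotation.

    Lower bound. The symbolic space of an exchange conjugate to T is invariant
    under the shift. If p(k + 1) <= p(k), every word of length k has a single
    continuation, so a sequence is determined by its first k letters, and the
    symbolic space is finite; but it is isomorphic to the torus, whose points are
    null. Hence p increases strictly from p(0) = 1, and p(k) > k. For the same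
    reason, if p(N) <= N + 1 for one N, then p(k) = k + 1 for all k <= N, and it
    remains to find, for arbitrarily large N, a conjugate exchange such that
    p(N) <= N + 1.

    Construction. Two lifts of T, that translate x by g ^ 2 and by - g, are coded
    by two letters. The first return maps of the rotation to intervals shrinking
    to 0 are the actions of two words P and Q, which are replaced by PQP and QP
    when the interval is reduced. The constant in T is the one for which the
    vertical displacement of these words is at most 1 in absolute value
    (block_offset, arrival_range). Above the next interval J, the returns are
    those of PQP and QP; as P and Q commute up to a vertical translation by 1,
    one of PQP and QPP, or one of QP and PQ, sends a point of J x [0, 1[ back to
    J x [0, 1[. The union of the points met on the way is a tower over this base,
    on which the letters define an exchange of two pieces; it is an exact
    fundamental domain of Z ^ 2, since the returns to J are first returns
    (tower_unique, tower_cover).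

    Complexity. All the codings are concatenations of P and Q. Long concatenations
    of P and Q end with a word W of length |P| + |Q| - 2 that does not depend on
    their order, so a factor of length |W| + 1 is determined by the place of its
    last letter in P or in Q: there are at most |W| + 2 of them (window_concat).

    Conjugacy. The coding of w determines the affine maps that send w to the
    points of its orbit. Almost every orbit is dense (visits_ae) and the tower is
    bounded, so the supremum of each coordinate along the orbit is its supremum
    over the tower; subtracting the supremum of the displacements recovers the
    coordinates of w (sups_orbit, decode_coding). The inverse of the coding is
    therefore explicit and measurable. *)

Set Implicit Arguments.
Unset Strict Implicit.
Unset Printing Implicit Defensive.
Import Order.TTheory GRing.Theory Num.Theory.
Import numFieldNormedType.Exports.
Local Open Scope classical_set_scope.
Local Open Scope ring_scope.

(** * Block words and their windows *)

Section words.

(** The words read by the successive inductions of the golden rotation: with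
    P = block n false and Q = block n true, the next pair is (PQP, QP). Up to
    conjugation these are the iterates of the square of the Fibonacci
    substitution. *)
Fixpoint block (n : nat) (c : bool) : seq bool :=
  if n is m.+1 then
    if c then block m true ++ block m false
    else block m false ++ block m true ++ block m false
  else [:: c].

Definition concat (n : nat) (bs : seq bool) : seq bool :=
  flatten (map (block n) bs).

(** The word W such that every long enough concatenation of the blocks P and Q
    of level n ends with W, whatever the order of the blocks. *)
Fixpoint central (n : nat) : seq bool :=
  if n is m.+1 then central m ++ block m.+1 false else [::].

Lemma size_block_gt0 n c : (0 < size (block n c))%N.
Proof. by elim: n c => [|n IH] [] //=; rewrite !size_cat ltn_addr ?IH. Qed.

Lemma size_blockS_false n : size (block n.+1 false) =
  (size (block n false) + size (block n false) + size (block n true))%N.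
Proof. by rewrite /= !size_cat; lia. Qed.

Lemma size_blockS_true n : size (block n.+1 true) =
  (size (block n false) + size (block n true))%N.
Proof. by rewrite /= !size_cat; lia. Qed.

Lemma size_block_lt n :
  (size (block n.+1 true) < size (block n.+1 false))%N.
Proof.
by rewrite size_blockS_false size_blockS_true; have := size_block_gt0 n false; lia.
Qed.

Lemma size_block_ge n : (n < size (block n true))%N.
Proof.
elim: n => // n IH; rewrite size_blockS_true.
by have := size_block_gt0 n false; lia.
Qed.

Lemma size_central n :
  (size (central n)).+2 = (size (block n false) + size (block n true))%N.
Proof.
elim: n => // n IH; rewrite [central _]/= size_cat -2!addSn IH.
by rewrite size_blockS_false size_blockS_true; lia.
Qed.

Lemma suffix_cat2r (s u v : seq bool) :
  suffix u v -> suffix (u ++ s) (v ++ s).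
Proof. by rewrite (@suffix_catl _ u v s s) // eqxx. Qed.

Lemma concat_cat n b1 b2 : concat n (b1 ++ b2) = concat n b1 ++ concat n b2.
Proof. by rewrite /concat map_cat flatten_cat. Qed.

Lemma concat_cons n c bs : concat n (c :: bs) = block n c ++ concat n bs.
Proof. by []. Qed.

(** With P' = PQP, Q' = QP and W' = W P', both W' P' = (W P') P' and
    W' Q' = (W PQ) P' consist of W, some blocks of level n and P'; as W followed
    by blocks of level n ends with W, they end with W P' = W'. *)
Lemma suffix_central n c : suffix (central n) (central n ++ block n c).
Proof.
elim: n c => [|n IH] c; first exact: suffix0s.
have IHs bs : suffix (central n) (central n ++ concat n bs).
  elim/last_ind: bs => [|bs d IHbs]; first by rewrite cats0 suffix_refl.
  rewrite -cats1 concat_cat catA /concat /= cats0.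
  by apply: suffix_trans (IH d) _; exact: suffix_cat2r.
have step bs u :
    suffix (central n ++ u) ((central n ++ concat n bs) ++ u).
  exact/suffix_cat2r/IHs.
case: c.
  have := step [:: false; true] (block n.+1 false).
  by rewrite /concat /= cats0 -!catA.
have := step [:: false; true; false] (block n.+1 false).
by rewrite /concat /= cats0 -!catA.
Qed.

Lemma suffix_central_concat n bs : suffix (central n) (central n ++ concat n bs).
Proof.
elim/last_ind: bs => [|bs c IH]; first by rewrite cats0 suffix_refl.
rewrite -cats1 concat_cat catA /concat /= cats0.
by apply: suffix_trans (suffix_central n c) _; exact: suffix_cat2r.
Qed.

Lemma take_concat n bs e : (0 < e <= size (concat n bs))%N ->
  exists bs' c r, [/\ take e (concat n bs) = concat n bs' ++ take r (block n c),
    (0 < r <= size (block n c))%N & e = (size (concat n bs') + r)%N].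
Proof.
elim: bs e => [|c bs IH] e; first by case: e.
rewrite concat_cons take_cat size_cat => /andP[e0 le].
case: ltnP => [lt|ge].
  by exists [::], c, e; split; rewrite // e0 ltnW.
have [->|ne] := eqVneq e (size (block n c)).
  exists [::], c, (size (block n c)).
  by rewrite subnn take0 cats0 take_size size_block_gt0 leqnn.
have [|bs' [c' [r [Et rb Ee]]]] := IH (e - size (block n c))%N.
  by apply/andP; split; move/eqP: ne; lia.
exists (c :: bs'), c', r; split => //.
  by rewrite Et concat_cons catA.
by rewrite concat_cons size_cat; lia.
Qed.

(** The word of length |W| + 1 that ends with the first r letters of a block
    preceded by W, for each block and each r. *)
Definition windows (n : nat) : seq (seq bool) :=
  let window c r := drop r.-1 (central n ++ take r (block n c)) in
  map (window false) (iota 1 (size (block n false))) ++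
  map (window true) (iota 1 (size (block n true))).

Lemma size_windows n : size (windows n) = (size (central n)).+2.
Proof. by rewrite size_cat !size_map !size_iota size_central. Qed.

(** A factor of length |W| + 1 of a concatenation is determined by the block that
    contains its last letter and by the position of this letter in the block,
    because the concatenation of the earlier blocks ends with W. As
    |P| + |Q| = |W| + 2, this leaves |W| + 2 factors of length |W| + 1. *)
Lemma window_concat n bs e (N := (size (central n)).+1) :
  (size (central n) + size (block n false) + size (block n true) <= e)%N ->
  (e <= size (concat n bs))%N ->
  drop (e - N) (take e (concat n bs)) \in windows n.
Proof.
move=> le1 le2.
have e0 : (0 < e <= size (concat n bs))%N.
  by rewrite le2 andbT; have := size_block_gt0 n false; move: le1; lia.
have [bs' [c [r [-> /andP[r0 rc] Ee]]]] := take_concat e0.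
have rle : (r <= size (block n false) + size (block n true))%N.
  by case: (c) rc; lia.
have szC : (size (central n) <= size (concat n bs'))%N by move: le1; lia.
have [t Et] : exists t : seq bool, concat n bs' = t ++ central n.
  apply/suffixP; have := suffix_central_concat n bs'.
  rewrite !suffixE size_cat addKn drop_cat => /eqP.
  rewrite ltnNge szC /= => E.
  by apply/eqP; exact: E.
rewrite Et -catA drop_cat; have -> : (e - N = size t + r.-1)%N.
  by rewrite Ee Et size_cat /N; move: r0; clear; lia.
rewrite ltnNge leq_addr /= addKn mem_cat; apply/orP.
by case: c rc => rc; [right|left]; apply/mapP; exists r => //;
  rewrite mem_iota add1n ltnS r0.
Qed.

End words.

(** * The golden mean and the affine action of words *)

Section golden_numbers.
Variable R : realType.

(** The inverse of the golden mean; all computations below rest on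
    gold ^ 2 = 1 - gold. *)
Definition gold : R := (Num.sqrt 5 - 1) / 2.

Lemma gold_sq : gold * gold = 1 - gold.
Proof.
have : Num.sqrt 5 ^+ 2 = 5 :> R by rewrite sqr_sqrtr.
by rewrite /gold; move: (Num.sqrt 5) => t; rewrite expr2 => tE; field: tE.
Qed.

Lemma gold_bounds : 1 / 2 < gold < 1.
Proof.
have t0 : 0 <= Num.sqrt 5 :> R by exact: sqrtr_ge0.
have : Num.sqrt 5 ^+ 2 = 5 :> R by rewrite sqr_sqrtr.
by rewrite /gold; move: (Num.sqrt 5) t0 => t t0 tE; apply/andP; split; nra.
Qed.

Lemma gold_gt0 : 0 < gold.
Proof. by case/andP: gold_bounds => *; lra. Qed.

Lemma goldenE : golden R = 1 + gold.
Proof. by rewrite /golden /gold; field. Qed.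

Lemma inv_golden_sq : 1 / golden R ^+ 2 = 1 - gold.
Proof.
have g0 := gold_gt0; have gs := gold_sq.
rewrite goldenE; apply: (canLR (mulfK _)); first by rewrite expf_neq0 ?gt_eqF //; lra.
by rewrite expr2; nra.
Qed.

Lemma inv_golden_cube : 1 / (2 * golden R ^+ 3) = (2 * gold - 1) / 2.
Proof.
have g0 := gold_gt0; have gs := gold_sq.
rewrite goldenE; apply: (canLR (mulfK _)).
  by rewrite mulf_neq0 ?expf_neq0 ?gt_eqF //; lra.
have -> : (1 + gold) ^+ 3 = 3 + 2 * gold.
  by rewrite !exprS expr0 mulr1; nra.
by nra.
Qed.

(** The letters act by the two lifts of T that move the first coordinate by
    gold ^ 2 and by - gold; the integer added to the second coordinate makes the
    mean vertical displacement vanish. *)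
Definition slide (c : bool) : R := 1 - gold - c%:R.

Definition rise (c : bool) : R := (-1) ^+ c - (2 * gold - 1) / 2.

Definition gen (c : bool) (z : plane R) : plane R :=
  (z.1 + slide c, z.2 + z.1 + rise c).

Definition lattice_shift (c : bool) : plane R := (c%:R, - (-1) ^+ c).

Lemma genE c z : gen c z = Tphi z - lattice_shift c.
Proof.
rewrite /gen /Tphi inv_golden_sq inv_golden_cube; congr pair => /=.
  by rewrite /slide; ring.
by rewrite /rise; ring.
Qed.

Lemma lattice_shift_Z2 c : lattice_shift c \in @Z2 R.
Proof. by rewrite inE /=; case: c; rewrite /= ?rpredN ?rpred0 ?rpred1. Qed.

(** The action of the word w, its first letter acting first, is
    (x, y) -> (x + disp w, y + |w| x + offset w). *)
Fixpoint disp (w : seq bool) : R := if w is c :: w' then slide c + disp w' else 0.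

Fixpoint offset (w : seq bool) : R :=
  if w is c :: w' then rise c + (size w')%:R * slide c + offset w' else 0.

Definition act (w : seq bool) (z : plane R) : plane R :=
  (z.1 + disp w, z.2 + (size w)%:R * z.1 + offset w).

Lemma act0 z : act [::] z = z.
Proof. by case: z => x y; rewrite /act /= mul0r !addr0. Qed.

Lemma act_cons c w z : act (c :: w) z = act w (gen c z).
Proof. by rewrite /act /gen /=; congr pair; rewrite -1?natr1; ring. Qed.

Lemma act_cat u v z : act (u ++ v) z = act v (act u z).
Proof.
elim: u z => [|c u IH] z; first by rewrite act0.
by rewrite cat_cons !act_cons IH.
Qed.

Lemma disp_cat u v : disp (u ++ v) = disp u + disp v.
Proof. by elim: u => [|c u IH] /=; rewrite ?add0r // IH addrA. Qed.

Lemma offset_cat u v :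
  offset (u ++ v) = offset u + offset v + (size v)%:R * disp u.
Proof.
elim: u => [|c u IH] /=; first by rewrite mulr0 addr0 add0r.
by rewrite IH size_cat natrD; ring.
Qed.

(** On the interval [- right_len n, left_len n[, the induced rotation translates
    the points at the left of 0 by left_len n and the others by - right_len n. *)
Definition sizeF n : R := (size (block n false))%:R.
Definition sizeT n : R := (size (block n true))%:R.
Definition right_len n : R := gold * (1 - gold) ^+ n.
Definition left_len n : R := gold * right_len n.

Lemma block_disp n : disp (block n false) = left_len n /\
  disp (block n true) = - right_len n.
Proof.
have gs := gold_sq.
elim: n => [|n [IHF IHT]].
  by rewrite /left_len /right_len /= /slide expr0; split; rewrite /=; nra.
rewrite /= !disp_cat IHF IHT /left_len /right_len exprS.
by move: (_ ^+ n) => t; split; ring: gs.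
Qed.

Lemma sizeFS n : sizeF n.+1 = sizeF n + sizeF n + sizeT n.
Proof. by rewrite /sizeF size_blockS_false !natrD. Qed.

Lemma sizeTS n : sizeT n.+1 = sizeF n + sizeT n.
Proof. by rewrite /sizeT size_blockS_true natrD. Qed.

Lemma left_lenS n : left_len n.+1 = 2 * left_len n - right_len n.
Proof. by have gs := gold_sq; rewrite /left_len /right_len exprS; ring: gs. Qed.

Lemma right_lenS n : right_len n.+1 = right_len n - left_len n.
Proof. by rewrite /left_len /right_len exprS; ring. Qed.

Lemma size_block_gold n : sizeT n = gold * sizeF n + left_len n.
Proof.
have gs := gold_sq.
elim: n => [|n IH]; first by rewrite /sizeT /sizeF /left_len /right_len /=; ring: gs.
rewrite sizeFS sizeTS IH left_lenS /left_len.
by move: (right_len n) (sizeF n) => t u; ring: gs.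
Qed.

(** The intervals of length right_len and left_len are the bases of two towers of
    heights sizeF and sizeT that fill the circle. *)
Lemma size_block_area n : sizeT n * left_len n + sizeF n * right_len n = 1.
Proof.
have gs := gold_sq.
elim: n => [|n IH]; first by rewrite /sizeT /sizeF /left_len /right_len /=; ring: gs.
rewrite -[RHS]IH.
by rewrite sizeFS sizeTS left_lenS right_lenS; ring.
Qed.

(** The vertical offsets stay bounded along the induction thanks to the constant
    1 / (2 phi ^ 3) in the definition of T: in the coordinate
    offset w - |w| disp w / 2 of the Heisenberg group, the induction is affine
    with fixed point (1/2, -1/2), and this constant puts the initial point on
    the stable line of the fixed point. *)
Lemma block_offset n :
  offset (block n false) = (1 + left_len n * (1 + sizeF n)) / 2 /\
  offset (block n true) = - (1 + right_len n * (1 + sizeT n)) / 2.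
Proof.
have gs := gold_sq.
elim: n => [|n [IHF IHT]].
  rewrite /left_len /right_len /sizeF /sizeT /= /rise /slide.
  by split; field: gs.
have [dF dT] := block_disp n; have ar := size_block_area n.
rewrite sizeFS sizeTS left_lenS right_lenS /= !offset_cat !size_cat.
rewrite !natrD -/(sizeF n) -/(sizeT n) IHF IHT dF dT.
move: ar.
move: (left_len n) (right_len n) (sizeF n) (sizeT n) => s r p q ar.
have {}ar : q * s = 1 - p * r by rewrite -ar; ring.
by split; field: ar.
Qed.

End golden_numbers.

(** * The rotation by 1 / phi ^ 2 *)

Section rotation.
Variable R : realType.
Local Notation g := (gold R).

Lemma disp_count w : disp R w = (size w)%:R * (1 - g) - (count id w)%:R.
Proof.
elim: w => [|c w IH] /=; first by rewrite mul0r subrr.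
by rewrite IH /slide natrD -natr1; ring.
Qed.

Lemma right_len_gt0 n : 0 < right_len R n.
Proof.
have /andP[g0 g1] := gold_bounds R.
by rewrite mulr_gt0 ?exprn_gt0 ?gold_gt0 // subr_gt0.
Qed.

Lemma left_len_gt0 n : 0 < left_len R n.
Proof. by rewrite mulr_gt0 ?gold_gt0 ?right_len_gt0. Qed.

Lemma left_len_lt_right n : left_len R n < right_len R n.
Proof.
have /andP[g0 g1] := gold_bounds R.
by rewrite /left_len gtr_pMl ?right_len_gt0.
Qed.

Lemma left_len_le n : left_len R n <= n.+1%:R^-1.
Proof.
have /andP[g0 g1] := gold_bounds R; have gs := gold_sq R.
elim: n => [|n IH].
  by rewrite /left_len /right_len expr0 mulr1 invr1; nra.
have -> : left_len R n.+1 = (1 - g) * left_len R n.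
  by rewrite /left_len /right_len exprS; ring.
apply: (le_trans (y := n.+1%:R^-1 / 2)).
  by have := left_len_gt0 n; move: (n.+1%:R^-1) IH => t; nra.
by rewrite -invfM lef_pV2 ?posrE ?mulr_gt0 // -natrM ler_nat; lia.
Qed.

Lemma left_len_small e : 0 < e -> exists n, left_len R n < e.
Proof.
move=> e0; exists (Num.truncn e^-1).+1.
apply: le_lt_trans (left_len_le _) _.
rewrite invf_plt ?posrE //; apply: lt_trans (truncnS_gt _) _.
by rewrite ltr_nat.
Qed.

(** The block of level n translates by left_len n modulo 1, which is positive and
    arbitrarily small; its multiples meet every interval. *)
Lemma rotation_dense (x lo hi : R) (K : nat) : lo < hi ->
  exists k (m : int), (K <= k)%N /\ lo < x + k%:R * (1 - g) - m%:~R < hi.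
Proof.
move=> lohi; have [n en] : exists n, left_len R n < hi - lo.
  by apply: left_len_small; rewrite subr_gt0.
have e0 := left_len_gt0 n; set e := left_len R n in e0 en.
pose M := (Num.truncn (`|x - lo| + K%:R * e)).+1.
have MK : K%:R * e < M%:R + lo - x.
  have := truncnS_gt (`|x - lo| + K%:R * e); rewrite -/M.
  by have := ler_norm (x - lo); lra.
have q0 : 0 <= (M%:R + lo - x) / e.
  apply: divr_ge0 (ltW e0); apply: le_trans (ltW MK).
  by rewrite mulr_ge0 ?ler0n ?ltW.
pose i := (Num.truncn ((M%:R + lo - x) / e)).+1.
have i1 : (M%:R + lo - x) < i%:R * e.
  by rewrite -ltr_pdivrMr //; exact: truncnS_gt.
have i2 : i%:R * e <= (M%:R + lo - x) + e.
  have := truncn_le ((M%:R + lo - x) / e); rewrite q0 ler_pdivlMr // => h.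
  have -> : i%:R = (Num.truncn ((M%:R + lo - x) / e))%:R + 1 :> R.
    by rewrite /i -natr1.
  by rewrite mulrDl mul1r lerD2r.
have [dF _] := block_disp R n; rewrite disp_count -/e in dF.
exists (i * size (block n false))%N.
exists (Posz (i * count id (block n false) + M)); split.
  have /ltnW : (K < i)%N by rewrite -(ltr_nat R) -(ltr_pM2r e0); lra.
  by have := size_block_gt0 n false; nia.
clearbody i M; rewrite -pmulrn natrD !natrM -[i%:R * _ * _]mulrA.
have -> : (size (block n false))%:R * (1 - g) = e + (count id (block n false))%:R.
  by rewrite -dF; ring.
by apply/andP; split; lra.
Qed.

Lemma int_le_ge (i : int) : (i%:~R : R) <= -1 \/ i = 0 \/ 1 <= (i%:~R : R).
Proof.
have : (i <= -1) \/ i = 0 \/ (1 <= i) by lia.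
case=> [h|[->|h]]; [left|by right; left|right; right].
  by rewrite -[-1]/((-1)%:~R) ler_int.
by rewrite -[1]/(1%:~R) ler_int.
Qed.

(** In the basis of the lattice Z ^ 2 given by the two blocks, a time d and an
    integer m are written d = i p + j q, with displacement i s - j r, where p and
    q are the sizes of the blocks. If i and j have opposite signs, the
    absolute displacement is at least the length r + s of the interval; otherwise
    0 < d < p leaves i = 0 and j > 0, so that d >= q, x < 0, and the translation
    by - j r sends x out of the interval. *)
Lemma no_early_return n (x : R) (d : nat) (m : int) :
  - right_len R n.+1 <= x < left_len R n.+1 ->
  - right_len R n.+1 <= x + d%:R * (1 - g) - m%:~R < left_len R n.+1 ->
  (0 < d < size (block n.+1 (0 <= x)%R))%N -> False.
Proof.
set s := left_len R n.+1; set r := right_len R n.+1.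
have s0 : 0 < s := left_len_gt0 _; have r0 : 0 < r := right_len_gt0 _.
have [dF dT] := block_disp R n.+1; have ar := size_block_area R n.+1.
move: dF dT ar; rewrite -/s -/r !disp_count /sizeF /sizeT.
have qp := size_block_lt n; have q0 := size_block_gt0 n.+1 true.
move=> dF dT ar /andP[x1 x2] /andP[y1 y2] /andP[d0 dlt].
have {dlt} : ((d < size (block n.+1 false))%N /\
   (0 <= x -> (d < size (block n.+1 true))%N)).
  by move: dlt; case: (lerP 0 x) => // h dlt; split => //; apply: ltn_trans qp.
case=> dp dq.
move: dF dT ar qp q0 dp dq; move: (block n.+1 false) (block n.+1 true) => F T.
move: (size F) (size T) (count id F) (count id T) => p q bF bT.
move=> dF dT ar qp q0 dp dq.
(* Cramer formulas; the determinant is 1 by size_block_area. *)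
pose i : int := d%:Z * bT%:Z - m * q%:Z.
pose j : int := p%:Z * m - d%:Z * bF%:Z.
have rE : r = bT%:R - q%:R * (1 - g) by rewrite -[r]opprK -dT; ring.
have detR : p%:R * bT%:R - q%:R * bF%:R = 1 :> R.
  by apply: etrans ar; rewrite -dF rE; ring.
have det : p%:Z * bT%:Z - q%:Z * bF%:Z = 1.
  apply: (@mulrIz R _ (oner_neq0 _)).
  by rewrite rmorphB !rmorphM /= -!pmulrn; exact: detR.
have dij : d%:Z = i * p%:Z + j * q%:Z.
  transitivity (d%:Z * (p%:Z * bT%:Z - q%:Z * bF%:Z)); first by rewrite det mulr1.
  by rewrite /i /j; ring.
have del : d%:R * (1 - g) - m%:~R = i%:~R * s - j%:~R * r.
  have {}detR : p%:R * bT%:R = 1 + q%:R * bF%:R :> R.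
    by apply/eqP; rewrite -subr_eq; apply/eqP.
  rewrite /i /j !rmorphB !rmorphM /= -!pmulrn -dF rE.
  move: (p%:R : R) (q%:R : R) (bT%:R : R) (bF%:R : R) (d%:R : R) (m%:~R : R) detR.
  by move=> p' q' bT' bF' d' m' detR; ring: detR.
have {}y1 : - r <= x + (i%:~R * s - j%:~R * r) by lra.
have {}y2 : x + (i%:~R * s - j%:~R * r) < s by lra.
have [hi|[hi|hi]] := int_le_ge i; have [hj|[hj|hj]] := int_le_ge j.
- have : (i <= -1) /\ (j <= -1) by rewrite -2!(ler_int R).
  by case=> a b; move: dij d0; clear -a b; nia.
- have : (i <= -1) by rewrite -(ler_int R).
  by move=> a; move: dij d0; rewrite hj; clear -a; nia.
- by nra.
- have : (j <= -1) by rewrite -(ler_int R).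
  by move=> a; move: dij d0; rewrite hi; clear -a; nia.
- by move: dij d0; rewrite hi hj; lia.
- have [x0|x0] := lerP 0 x.
    have {}dq := dq x0.
    have : (1 <= j) by rewrite -(ler_int R).
    by move=> a; move: dij dq; rewrite hi; clear -a; nia.
  by move: y1; rewrite hi mul0r sub0r; nra.
- by nra.
- have : (1 <= i) by rewrite -(ler_int R).
  by move=> a; move: dij dp; rewrite hj; clear -a; nia.
- have : (1 <= i) /\ (1 <= j) by rewrite -2!(ler_int R).
  by case=> a b; move: dij dp; clear -a b; nia.
Qed.

End rotation.

(** * The base of the tower and its first return map *)

Section tower_base.
Variables (R : realType) (n : nat).
Local Notation g := (gold R).
Local Notation F := (block n.+1 false).
Local Notation T := (block n.+1 true).
Local Notation s := (left_len R n.+1).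
Local Notation r := (right_len R n.+1).

(** The base is an interval of the induced rotation times a vertical fundamental
    interval. The blocks of level n.+1 bring it back over the interval, but they
    may land one unit above or below the strip 0 <= y < 1. *)
Definition base : set (plane R) :=
  [set z | (- r <= z.1 < s) && (0 <= z.2 < 1)].

Definition arrival (z : plane R) : plane R := act (block n.+1 (0 <= z.1)) z.

Definition swapped (z : plane R) : bool := ~~ (0 <= (arrival z).2 < 1).

(** The blocks of level n that replace the block of level n.+1: PQP or QPP for a
    point at the left of 0, QP or PQ for the others. *)
Definition route (b sw : bool) : seq bool :=
  if b then (if sw then [:: false; true] else [:: true; false])
  else (if sw then [:: true; false; false] else [:: false; true; false]).

Definition itinerary (z : plane R) : seq bool :=
  concat n (route (0 <= z.1) (swapped z)).

Lemma concat_route b : concat n (route b false) = block n.+1 b.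
Proof. by case: b; rewrite /concat /= cats0 // -!catA. Qed.

Lemma size_concat_route b sw :
  size (concat n (route b sw)) = size (block n.+1 b).
Proof.
rewrite -concat_route; case: b; case: sw; rewrite /concat /= !size_cat /=; lia.
Qed.

Lemma size_itinerary z : size (itinerary z) = size (block n.+1 (0 <= z.1)).
Proof. exact: size_concat_route. Qed.

(** Exchanging two consecutive blocks PQ changes the second coordinate by the
    commutator of their actions, which is 1 by size_block_area; this is the
    vertical correction that brings the point back to the base. *)
Lemma act_route b (z : plane R) :
  act (concat n (route b true)) z =
  ((act (block n.+1 b) z).1, (act (block n.+1 b) z).2 - (-1) ^+ b).
Proof.
have [dF dT] := block_disp R n.
have ar : sizeT R n * left_len R n = 1 - sizeF R n * right_len R n.
  by rewrite -(size_block_area R n); ring.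
rewrite -concat_route; case: b; rewrite /concat /act /= !cats0;
  rewrite !disp_cat !offset_cat !size_cat !natrD dF dT;
  rewrite -/(sizeF R n) -/(sizeT R n); congr pair => //; first by ring.
- by ring: ar.
- by ring.
- by ring: ar.
Qed.

Lemma act_itinerary z : act (itinerary z) z =
  ((arrival z).1, (arrival z).2 - (if swapped z then (-1) ^+ (0 <= z.1)%R else 0)).
Proof.
rewrite /itinerary /arrival; case: (swapped z); first exact: act_route.
by rewrite concat_route subr0 -surjective_pairing.
Qed.

Lemma arrivalE z : arrival z = if 0 <= z.1
  then (z.1 - r, z.2 + sizeT R n.+1 * z.1 - (1 + r * (1 + sizeT R n.+1)) / 2)
  else (z.1 + s, z.2 + sizeF R n.+1 * z.1 + (1 + s * (1 + sizeF R n.+1)) / 2).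
Proof.
have [dF dT] := block_disp R n.+1; have [oF oT] := block_offset R n.+1.
by rewrite /arrival /act; case: ifP => _; rewrite ?dF ?dT ?oF ?oT // mulNr.
Qed.

Lemma tower_params : [/\ 0 < s, s < r, r = s + g * s, 1 <= sizeT R n.+1 &
  sizeT R n.+1 + 1 <= sizeF R n.+1 /\
  sizeT R n.+1 = g * sizeF R n.+1 + s /\
  sizeT R n.+1 * s + sizeF R n.+1 * r = 1].
Proof.
split; [exact: left_len_gt0 | exact: left_len_lt_right | | | do 2?split].
- by have gs := gold_sq R; rewrite /left_len; move: (right_len _ _) => t; ring: gs.
- by rewrite ler1n size_block_gt0.
- by rewrite natr1 ler_nat size_block_lt.
- exact: size_block_gold.
- exact: size_block_area.
Qed.

(** Since the arrival is never further than one unit from the strip, and on one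
    side only, one exchange of blocks is enough. *)
Lemma arrival_range z : base z ->
  if 0 <= z.1 then -1 <= (arrival z).2 < 1 else 0 <= (arrival z).2 < 2.
Proof.
move=> /andP[/andP[x1 x2] /andP[y1 y2]]; rewrite arrivalE.
have [s0 sr rE q1 [qp [qE ar]]] := tower_params.
have /andP[g0 g1] := gold_bounds R.
move: (sizeF R n.+1) (sizeT R n.+1) q1 qp qE ar => p q q1 qp qE ar.
case: (lerP 0 z.1) => /= x0.
  have h1 : 0 <= q * z.1 by rewrite mulr_ge0 //; lra.
  have h2 : q * z.1 <= q * s by rewrite ler_wpM2l //; lra.
  have h3 : 0 <= s * (q - 0) by rewrite mulr_ge0; lra.
  have h4 : 0 <= r * (p - q - 1) by rewrite mulr_ge0; lra.
  have h5 : s * q < r * q by rewrite ltr_pM2r; lra.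
  by apply/andP; split; lra.
have h1 : p * z.1 <= 0 by rewrite mulr_ge0_le0; lra.
have h2 : p * - r <= p * z.1 by rewrite ler_wpM2l; lra.
have h3 : 0 <= s * (q - 1) by rewrite mulr_ge0; lra.
have h4 : 0 <= p * (r - s) by rewrite mulr_ge0; lra.
have h5 : 0 <= s * (1 + q - g * p) by rewrite mulr_ge0; lra.
have h6 : p * r = s * p + g * p * s by rewrite rE; ring.
by apply/andP; split; lra.
Qed.

Lemma base_return z : base z -> base (act (itinerary z) z).
Proof.
move=> bz; have := arrival_range bz; move: bz => /andP[/andP[x1 x2] /andP[y1 y2]].
rewrite act_itinerary /base /swapped; have := arrivalE z.
have [s0 sr _ _ _] := tower_params.
case: (lerP 0 z.1) => x0 -> /= yr; apply/andP; split.
- by lra.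
- move: yr; move: (_ - _ / 2) => y yr; case: ifP; rewrite ?expr1; last first.
    by move/negbFE; rewrite subr0.
  by rewrite negb_and -!ltNge => /orP h; lra.
- by lra.
- move: yr; move: (_ + _ / 2) => y yr; case: ifP; rewrite ?expr0; last first.
    by move/negbFE; rewrite subr0.
  by rewrite negb_and -!ltNge => /orP h; lra.
Qed.

Lemma eq_unit_interval (a b : R) : 0 <= a < 1 -> 0 <= b < 1 ->
  a - b \is a Num.int -> a = b.
Proof.
move=> /andP[a0 a1] /andP[b0 b1] /intrP[m abm].
have [h|[h|h]] := int_le_ge R m; [lra| |lra].
by move: abm; rewrite h => /eqP; rewrite subr_eq0 => /eqP.
Qed.

Lemma base_return_surj z' : base z' -> exists2 z, base z & act (itinerary z) z = z'.
Proof.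
move=> /andP[/andP[x1 x2] /andP[y1 y2]].
have [s0 sr _ _ _] := tower_params.
pose x := if z'.1 < s - r then z'.1 + r else z'.1 - s.
pose rot := (arrival (x, 0)).2.
pose t := z'.2 - rot.
pose z : plane R := (x, t - (Num.floor t)%:~R).
have bz : base z.
  apply/andP; split; last first.
    by have := floorD1_gt t; have := floor_le t; rewrite intrD => *; apply/andP; split => /=; lra.
  by rewrite /= /x; case: ltP => ?; apply/andP; split; lra.
exists z => //; have := base_return bz; rewrite act_itinerary => /andP[_ yr].
rewrite [RHS]surjective_pairing; congr pair.
  by rewrite arrivalE /= /x; case: ltP => h; case: lerP => h' /=; lra.
apply: eq_unit_interval => //; first by rewrite y1.
have -> : (arrival z).2 = z'.2 - (Num.floor t)%:~R.
  have : (arrival z).2 = z.2 + rot by rewrite /rot !arrivalE /=; case: ifP => /= _; ring.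
  by move=> ->; rewrite /z /= /t; ring.
set e := (if swapped z then _ else _).
rewrite (_ : _ - z'.2 = - (Num.floor t)%:~R - e); last by ring.
rewrite rpredB ?rpredN ?intr_int // /e.
by case: ifP => _; rewrite ?rpred0 // rpredX // rpredN rpred1.
Qed.

(** The sets of points of the base that follow a given itinerary are bounded
    from above by strict inequalities and from below by large ones, and the
    vertical displacement increases with x; so they contain a small square
    above and to the right of each of their points. *)
Lemma itinerary_stable z : base z -> exists2 d : R, 0 < d & forall z',
  z.1 <= z'.1 < z.1 + d -> z.2 <= z'.2 < z.2 + d ->
  base z' /\ itinerary z' = itinerary z.
Proof.
move=> bz; have [s0 sr _ q1 [qp _]] := tower_params.
have K0 : 0 < 1 + sizeF R n.+1 by lra.
pose a := (arrival z).2.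
pose gap := (if a < 0 then - a else if a < 1 then 1 - a else 1) / (1 + sizeF R n.+1).
have gap0 : 0 < gap.
  by rewrite divr_gt0 //; case: (ltP a 0) => h; [lra|case: (ltP a 1) => h'; lra].
move: (bz) => /andP[/andP[x1 x2] /andP[y1 y2]].
pose d := Num.min (Num.min (s - z.1) (1 - z.2))
                  (Num.min (if z.1 < 0 then - z.1 else 1) gap).
exists d.
  rewrite /d !lt_min gap0 !subr_gt0 x2 y2 /=; case: (ltP z.1 0) => h; lra.
move=> z' /andP[a1 a2] /andP[b1 b2].
have dE t : (t < d) -> [/\ t < s - z.1, t < 1 - z.2,
    t < (if z.1 < 0 then - z.1 else 1) & t < gap].
  by rewrite /d !lt_min => /andP[/andP[? ?] /andP[? ?]]; split.
have /dE [u1 _ u3 u4] : z'.1 - z.1 < d by lra.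
have /dE [_ v2 _ v4] : z'.2 - z.2 < d by lra.
have bz' : base z' by apply/andP; split; apply/andP; split; lra.
have sgn : (0 <= z'.1) = (0 <= z.1).
  by move: u3; case: (ltP z.1 0) => h h'; [apply/negbTE; rewrite -ltNge; lra|apply/idP; lra].
split => //; rewrite /itinerary sgn /swapped; congr (concat n (route _ (~~ _))).
have : a <= (arrival z').2 /\ (arrival z').2 < a + gap * (1 + sizeF R n.+1).
  rewrite /a !arrivalE sgn; move: (sizeF R n.+1) (sizeT R n.+1) q1 qp K0 u4 => p q q1 qp K0 u4.
  have e0 : 0 <= z'.1 - z.1 by lra.
  move: (z'.1 - z.1) e0 u4 (subrK z.1 z'.1) => e e0 u4 <-.
  case: ifP => _ /=.
    have h1 : 0 <= q * e by rewrite mulr_ge0 //; lra.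
    have h2 : q * e <= p * gap by rewrite ler_pM //; lra.
    by rewrite !mulrDr mulr1; lra.
  have h1 : 0 <= p * e by rewrite mulr_ge0 //; lra.
  have h2 : p * e <= p * gap by rewrite ler_pM //; lra.
  by rewrite !mulrDr mulr1; lra.
rewrite /gap divfK ?gt_eqF // -/a => -[l1 l2].
have r1 := arrival_range bz; have r2 := arrival_range bz'.
move: r1 r2 l1 l2; rewrite sgn -/a; case: ifP => _ /andP[r1 r1'] /andP[r2 r2'] l1.
  case: (ltP a 0) => h l2.
    by apply/negbTE; rewrite negb_and -!ltNge; lra.
  by rewrite r1' r2' (le_trans h l1).
case: (ltP a 0) => h; first by move: h; rewrite ltNge r1.
case: (ltP a 1) => h' l2; first by move: l2; rewrite addrC subrK (le_trans h l1).
by apply/negbTE; rewrite negb_and -!ltNge; lra.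
Qed.

End tower_base.

(** * The tower over the base *)

Section lattice_congruence.
Variable R : realType.
Local Notation g := (gold R).
Implicit Types w z : plane R.

Lemma eqmodZ2P w z : reflect
  (w.1 - z.1 \is a Num.int /\ w.2 - z.2 \is a Num.int) (eqmodZ2 w z).
Proof. by rewrite /eqmodZ2 inE /=; exact: andP. Qed.

Lemma TphiE z : Tphi z = (z.1 + (1 - g), z.2 + z.1 - (2 * g - 1) / 2).
Proof. by rewrite /Tphi inv_golden_sq inv_golden_cube. Qed.

Lemma eqmod_Tphi w z : eqmodZ2 (Tphi w) (Tphi z) = eqmodZ2 w z.
Proof.
apply/eqmodZ2P/eqmodZ2P; rewrite !TphiE /= => -[h1 h2].
  have {}h1 : w.1 - z.1 \is a Num.int by rewrite [X in X \is a _](_ : _ =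
    w.1 + (1 - g) - (z.1 + (1 - g))) //; ring.
  split=> //; rewrite [X in X \is a _](_ : _ = (w.2 + w.1 - (2 * g - 1) / 2 -
    (z.2 + z.1 - (2 * g - 1) / 2)) - (w.1 - z.1)); first exact: rpredB.
  by ring.
split; first by rewrite [X in X \is a _](_ : _ = w.1 - z.1) //; ring.
rewrite [X in X \is a _](_ : _ = (w.1 - z.1) + (w.2 - z.2)); first exact: rpredD.
by ring.
Qed.

Lemma eqmod_iter_Tphi k w z :
  eqmodZ2 (iter k (@Tphi R) w) (iter k (@Tphi R) z) = eqmodZ2 w z.
Proof. by elim: k => //= k IH; rewrite eqmod_Tphi. Qed.

Lemma eqmod_gen c z : eqmodZ2 (gen c z) (Tphi z).
Proof.
rewrite genE /eqmodZ2 addrAC subrr sub0r.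
by have := lattice_shift_Z2 R c; rewrite !inE /= !rpredN.
Qed.

Lemma eqmod_act u z : eqmodZ2 (act u z) (iter (size u) (@Tphi R) z).
Proof.
elim: u z => [|c u IH] z; first by rewrite act0 eqmodZ2_refl.
rewrite act_cons iterSr; apply: eqmodZ2_trans (IH _) _.
by rewrite eqmod_iter_Tphi eqmod_gen.
Qed.

(** The second coordinate turns at speed k when x varies. *)
Lemma iter_TphiE k z : iter k (@Tphi R) z =
  (z.1 + k%:R * (1 - g), z.2 + k%:R * z.1 + (iter k (@Tphi R) 0).2).
Proof.
have fst k' z' : (iter k' (@Tphi R) z').1 = z'.1 + k'%:R * (1 - g).
  elim: k' => [|k' IH]; first by rewrite mul0r addr0.
  by rewrite iterS TphiE /= IH -natr1; ring.
rewrite [LHS]surjective_pairing fst; congr pair.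
elim: k => [|k IH]; first by rewrite /= mul0r !addr0.
by rewrite !iterS !TphiE /= !fst IH -natr1 /=; ring.
Qed.

End lattice_congruence.

Section tower.
Variables (R : realType) (n : nat).
Local Notation g := (gold R).
Local Notation base := (@base R n).
Local Notation itinerary := (@itinerary R n).
Implicit Types w z : plane R.

Definition position z j : plane R := act (take j (itinerary z)) z.

Definition tower_piece (c : bool) : set (plane R) :=
  [set w | exists z j, [/\ base z, (j < size (itinerary z))%N,
     nth false (itinerary z) j = c & w = position z j]].

Definition tower : set (plane R) := tower_piece false `|` tower_piece true.

Definition letter_at w : bool := `[< tower_piece true w >].

Definition step w : plane R := gen (letter_at w) w.

Lemma size_itinerary_gt0 z : (0 < size (itinerary z))%N.
Proof. by rewrite size_itinerary size_block_gt0. Qed.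

Lemma eqmod_position z j : (j <= size (itinerary z))%N ->
  eqmodZ2 (position z j) (iter j (@Tphi R) z).
Proof.
by move=> js; have := eqmod_act (take j (itinerary z)) z; rewrite size_takel.
Qed.

(** Going down from two congruent points of the tower leads to a point of the
    base that comes back over the base interval in a time smaller than the
    height of the tower. *)
Lemma tower_unique z z' i j : base z -> base z' ->
  (i < size (itinerary z))%N -> (j < size (itinerary z'))%N ->
  eqmodZ2 (position z i) (position z' j) -> z = z' /\ i = j.
Proof.
wlog ij : z z' i j / (i <= j)%N.
  move=> H bz bz' iz jz' e; case: (leqP i j) => [|/ltnW] ij; first exact: H.
  by have [|-> ->] := H z' z j i ij bz' bz jz' iz; rewrite // eqmodZ2_sym.
move=> bz bz' iz jz' e.
have {e} : eqmodZ2 z (iter (j - i) (@Tphi R) z').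
  rewrite -(eqmod_iter_Tphi i) -iterD subnKC //.
  apply: eqmodZ2_trans (eqmod_position (ltnW jz')).
  by apply: eqmodZ2_trans e; rewrite eqmodZ2_sym eqmod_position // ltnW.
move=> /eqmodZ2P; rewrite iter_TphiE /= => -[h1 h2].
move: (bz) (bz') => /andP[xz yz] /andP[xz' yz'].
have ij' : i = j.
  apply/eqP; rewrite eqn_leq ij /= leqNgt; apply/negP => ltij.
  move/intrP: h1 => [m h1].
  apply: (@no_early_return R n z'.1 (j - i) (- m)) => //.
    rewrite (_ : _ - _ = z.1) // rmorphN /= opprK -h1.
    by rewrite addrC subrK.
  by rewrite subn_gt0 ltij -size_itinerary; move: jz'; lia.
subst j; move: h1 h2; rewrite subnn /= !mul0r !addr0 => h1 h2; split => //.
have [m h1m] := intrP h1.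
have [_ _ rE _ _] := tower_params R n; have /andP[g0 g1] := gold_bounds R.
have s0 := left_len_gt0 R n.+1.
have z1 : z.1 = z'.1.
  have rb : left_len R n.+1 + right_len R n.+1 <= 1.
    have := size_block_area R n.+1; rewrite /sizeF /sizeT => <-.
    rewrite lerD // ler_peMl ?ler1n ?size_block_gt0 // ltW //.
    exact: right_len_gt0.
  have [h|[h|h]] := int_le_ge R m; [lra| |lra].
  by move: h1m; rewrite h => /eqP; rewrite subr_eq0 => /eqP.
rewrite [z]surjective_pairing [z' in RHS]surjective_pairing z1; congr pair.
exact: eq_unit_interval.
Qed.

Lemma tower_piece_disjoint w : tower_piece true w -> ~ tower_piece false w.
Proof.
move=> [z [j [bz js ct ->]]] [z' [j' [bz' js' cf /(congr1 (eqmodZ2 (position z j)))]]].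
rewrite eqmodZ2_refl => /esym e.
by have [zz jj] := tower_unique bz bz' js js' e; move: cf; rewrite -zz -jj ct.
Qed.

Lemma letter_atP c w : tower_piece c w -> letter_at w = c.
Proof.
rewrite /letter_at; case: c => h; first exact/asboolT.
by apply/asboolF => h'; exact: tower_piece_disjoint h' h.
Qed.

Lemma tower_letter_at w : tower w -> tower_piece (letter_at w) w.
Proof. by case=> h; rewrite (letter_atP h). Qed.

Lemma towerP w : tower w <->
  exists z j, [/\ base z, (j < size (itinerary z))%N & w = position z j].
Proof.
split; first by case=> -[z [j [bz js _ ->]]]; exists z, j.
move=> [z [j [bz js ->]]].
by case E: (nth false (itinerary z) j); [right|left]; exists z, j.
Qed.

Lemma position0 z : position z 0 = z.
Proof. by rewrite /position take0 act0. Qed.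

Lemma base_tower z : base z -> tower z.
Proof.
move=> bz; apply/towerP; exists z, 0%N.
by rewrite position0 size_itinerary_gt0.
Qed.

Lemma letter_at_position z j : base z -> (j < size (itinerary z))%N ->
  letter_at (position z j) = nth false (itinerary z) j.
Proof. by move=> bz js; apply: letter_atP; exists z, j. Qed.

Lemma step_position z j : base z -> (j < size (itinerary z))%N ->
  step (position z j) = position z j.+1.
Proof.
move=> bz js; rewrite /step letter_at_position // /position.
by rewrite (take_nth false js) -cats1 act_cat act_cons act0.
Qed.

Lemma iter_step_base z j : base z -> (j <= size (itinerary z))%N ->
  iter j step z = position z j.
Proof.
move=> bz; elim: j => [|j IH] js; first by rewrite position0.
by rewrite iterS IH ?step_position // ltnW.
Qed.

Lemma iter_step_return z : base z ->
  iter (size (itinerary z)) step z = act (itinerary z) z.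
Proof. by move=> bz; rewrite iter_step_base // /position take_size. Qed.

Lemma step_tower w : tower w -> tower (step w).
Proof.
move=> /towerP[z [j [bz js ->]]]; rewrite step_position //.
move: js; rewrite leq_eqVlt => /orP[/eqP js|js].
  rewrite /position js take_size; exact/base_tower/base_return.
by apply/towerP; exists z, j.+1.
Qed.

Lemma iter_step_tower k w : tower w -> tower (iter k step w).
Proof. by move=> tw; elim: k => //= k; exact: step_tower. Qed.

Lemma eqmod_iter_step k w : eqmodZ2 (iter k step w) (iter k (@Tphi R) w).
Proof.
elim: k => [|k IH]; first exact: eqmodZ2_refl.
by rewrite !iterS; apply: eqmodZ2_trans (eqmod_gen _ _) _; rewrite eqmod_Tphi.
Qed.

Lemma tower_inj w w' : tower w -> tower w' -> eqmodZ2 w w' -> w = w'.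
Proof.
move=> /towerP[z [j [bz js ->]]] /towerP[z' [j' [bz' js' ->]]] e.
by have [-> ->] := tower_unique bz bz' js js' e.
Qed.

(** The backward rotation of w enters the base interval; the tower is invariant
    under the lifted map, so it contains a point congruent to w. *)
Lemma tower_cover w : exists2 w', tower w' & eqmodZ2 w w'.
Proof.
have s0 := left_len_gt0 R n.+1; have r0 := right_len_gt0 R n.+1.
have [|k [m [_ /andP[k1 k2]]]] :=
  @rotation_dense R (- w.1) (- left_len R n.+1) (right_len R n.+1) 0; first by lra.
pose x := w.1 - k%:R * (1 - g) + m%:~R.
pose t := w.2 - k%:R * x - (iter k (@Tphi R) 0).2.
pose z : plane R := (x, t - (Num.floor t)%:~R).
have bz : base z.
  apply/andP; split; first by rewrite /= /x; apply/andP; split; lra.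
  by have := floorD1_gt t; have := floor_le t; rewrite intrD => *;
    apply/andP; split => /=; lra.
exists (iter k step z); first exact/iter_step_tower/base_tower.
rewrite eqmodZ2_sym; apply: eqmodZ2_trans (eqmod_iter_step _ _) _.
apply/eqmodZ2P; rewrite iter_TphiE /=; split.
  rewrite [X in X \is a _](_ : _ = m%:~R); first exact: intr_int.
  by rewrite /x; ring.
rewrite [X in X \is a _](_ : _ = - (Num.floor t)%:~R).
  by rewrite rpredN intr_int.
by rewrite {1}/t; ring.
Qed.

Definition tower_code w (k : nat) : bool := letter_at (iter k step w).

Lemma code_concat K z : base z -> exists2 bs, (K <= size bs)%N &
  forall i, (i < size (concat n bs))%N -> tower_code z i = nth false (concat n bs) i.
Proof.
elim: K z => [|K IH] z bz; first by exists [::].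
have [bs Kbs cE] := IH _ (base_return bz).
exists (route (0 <= z.1) (swapped n z) ++ bs).
  by rewrite size_cat; case: (0 <= z.1); case: (swapped n z) => /=; lia.
move=> i; rewrite concat_cat -/(itinerary z) size_cat nth_cat => lt'.
case: ltnP => [lt|ge]; rewrite /tower_code.
  by rewrite iter_step_base ?(ltnW lt) // letter_at_position.
rewrite -cE; last by rewrite ltn_subLR.
by rewrite /tower_code -iter_step_return // -iterD subnK.
Qed.

(** Sequences of letters are one-sided, so that a past has to be built for the
    blocks before a given letter to be long enough. *)
Lemma backward_orbit K z : base z -> exists z' J,
  [/\ base z', (K <= J)%N & iter J step z' = z].
Proof.
elim: K z => [|K IH] z bz; first by exists z, 0%N.
have [z1 b1 e1] := base_return_surj bz.
have [z2 [J [b2 KJ e2]]] := IH _ b1.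
exists z2, (size (itinerary z1) + J)%N; split => //.
  by have := size_itinerary_gt0 z1; move: KJ; lia.
by rewrite iterD e2 iter_step_return.
Qed.

Lemma tower_code_iter k w i : tower_code (iter k step w) i = tower_code w (k + i)%N.
Proof. by rewrite /tower_code -iterD addnC. Qed.

Lemma code_windows w : tower w ->
  mkseq (tower_code w) (size (central n)).+1 \in windows n.
Proof.
move=> /towerP[z [j [bz js ->]]]; set N := (size (central n)).+1.
pose B := (size (central n) + size (block n false) + size (block n true))%N.
(* B letters of the past leave room for the central word. *)
have [z' [J [bz' BJ zE]]] := backward_orbit B bz.
rewrite -(iter_step_base bz (ltnW js)) -zE -iterD.
pose e := (j + J + N)%N.
have [bs ebs cE] := code_concat e bz'.
have ecs : (e <= size (concat n bs))%N.
  apply: leq_trans ebs _; elim: (bs) => //= b bs' IH.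
  by rewrite concat_cons size_cat; have := size_block_gt0 n b; lia.
have Be : (B <= e)%N by move: BJ; rewrite /e; lia.
have := window_concat Be ecs.
suff -> : drop (e - N) (take e (concat n bs)) =
    mkseq (tower_code (iter (j + J) step z')) N by [].
apply: (@eq_from_nth _ false).
  by rewrite size_mkseq size_drop size_takel // /e; lia.
move=> i; rewrite size_drop size_takel // => iN.
have iN' : (i < N)%N by move: iN; rewrite /e; lia.
rewrite nth_mkseq // nth_drop nth_take; last by rewrite /e; move: iN'; lia.
rewrite tower_code_iter (_ : e - N = j + J)%N; last by rewrite /e; lia.
by rewrite cE //; apply: leq_trans ecs; rewrite /e; move: iN'; lia.
Qed.

End tower.

(** * Density of almost every orbit *)

Section density_points.
Variable R : realType.
Local Notation mu := (@lebesgue_measure R).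

(** A point where E misses a fixed proportion of arbitrarily small balls is not a
    density point of E. *)
Lemma null_of_uniform_gaps (E : set R) (c : R) : measurable E -> 0 < c ->
  (forall x e, E x -> 0 < e -> exists r u v : R, [/\ 0 < r < e,
     x - r <= u /\ v <= x + r, c * r <= v - u &
     forall t, u < t < v -> ~ E t]) ->
  mu E = 0.
Proof.
move=> mE c0 gaps.
have [N [mN N0 sN]] := lebesgue_density mE.
suff EN : E `<=` N by apply/eqP; rewrite -measure_le0 -N0 le_measure ?inE.
move=> x Ex; apply: sN => /= dx.
have E1 : \1_E x = 1 :> R by rewrite indicE mem_set.
move: dx; rewrite E1 => /fine_cvgP[_ /cvgrPdist_lt dx].
have c2 : 0 < c / 2 by lra.
have /= [e e0 He] := dx _ c2.
have [r [u [v [/andP[r0 re] [ru rv] cuv gap]]]] := gaps x e Ex e0.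
have /= := He r _ r0; rewrite sub0r normrN gtr0_norm // => /(_ re).
have mball : measurable (ball x r) by exact: measurable_ball.
have bE : mu (ball x r) = (r *+ 2)%:E by rewrite lebesgue_measure_ball // ltW.
have uv : u <= v by have := mulr_gt0 c0 r0; lra.
have iB : `]u, v[%classic `<=` ball x r.
  move=> t /=; rewrite in_itv /= => /andP[t1 t2].
  by rewrite /ball /= ltr_norml; apply/andP; split; lra.
have le1 : (mu (E `&` ball x r) <= (r *+ 2 - (v - u))%:E)%E.
  apply: (@le_trans _ _ (mu (ball x r `\` `]u, v[%classic))).
    apply: le_measure; rewrite ?inE //.
    - exact: measurableI.
    - exact: measurableD.
    - move=> t [Et Bt]; split => // /=; rewrite in_itv /= => tuv.
      exact: gap tuv Et.
  have fb : (mu (ball x r) < +oo)%E by rewrite bE ltry.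
  have mD : mu (ball x r `\` `]u, v[%classic) =
      (mu (ball x r) - mu (ball x r `&` `]u, v[%classic))%E.
    by apply: measureD.
  rewrite mD setIidr // lebesgue_measure_itv /= bE lte_fin.
  case: ltP => vu; rewrite -?EFinB ?sube0 lee_fin //.
  by have -> : v - u = 0 by lra; rewrite subr0.
have fin : mu (E `&` ball x r) \is a fin_num.
  by rewrite ge0_fin_numE // (le_lt_trans le1) // ltry.
rewrite bE inver mulrn_eq0 /= gt_eqF //= fineM //=.
have : fine (mu (E `&` ball x r)) <= r *+ 2 - (v - u) by rewrite -lee_fin fineK.
move: (fine _) => f fle.
have r20 : 0 < r *+ 2 by rewrite mulr2n; lra.
have : f / (r *+ 2) <= 1 - c / 2.
  rewrite ler_pdivrMr // mulr2n; move: fle; rewrite mulr2n => fle.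
  have : (1 - c / 2) * (r + r) = r + r - c * r by field.
  by move=> ->; lra.
by move=> h1 /ltr_normlW; lra.
Qed.

End density_points.

Section visits.
Variable R : realType.
Local Notation g := (gold R).
Local Notation mu := (@lebesgue_measure R).
Implicit Types w z a b : plane R.

(** Passages after time K in the box with corners a and b, modulo Z ^ 2. *)
Definition visits (a b : plane R) (K : nat) : set (plane R) :=
  [set w | exists k (m1 m2 : int), [/\ (K <= k)%N,
     a.1 < (iter k (@Tphi R) w).1 - m1%:~R < b.1 &
     a.2 < (iter k (@Tphi R) w).2 - m2%:~R < b.2]].

Lemma measurable_visits a b K : measurable (visits a b K).
Proof.
pose V k (m1 m2 : int) : set (plane R) := [set w |
     a.1 < (iter k (@Tphi R) w).1 - m1%:~R < b.1 /\
     a.2 < (iter k (@Tphi R) w).2 - m2%:~R < b.2].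
rewrite [X in measurable X](_ : _ = \bigcup_(k in [set k | (K <= k)%N])
  \bigcup_m1 \bigcup_m2 V k m1 m2); last first.
  apply/seteqP; split=> [w [k [m1 [m2 [h1 h2 h3]]]]|w [k h1 [m1 _ [m2 _ [h2 h3]]]]].
    by exists k => //; exists m1 => //; exists m2.
  by exists k, m1, m2.
apply: bigcup_measurable => k _; apply: countable_bigcupT_measurable => // m1.
apply: countable_bigcupT_measurable => // m2.
have mT : measurable_fun setT (iter k (@Tphi R)).
  rewrite (_ : iter k _ = fun w => (w.1 + k%:R * (1 - g),
      w.2 + k%:R * w.1 + (iter k (@Tphi R) 0).2)); last first.
    by apply/funext => w; rewrite iter_TphiE.
  apply/measurable_fun_pairP; split => /=.
    by apply: measurable_funD.
  by apply: measurable_funD => //; apply: measurable_funD => //; apply: measurable_funM.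
rewrite [V _ _ _](_ : _ = setT `&` iter k (@Tphi R) @^-1`
   (`]a.1 + m1%:~R, b.1 + m1%:~R[ `*` `]a.2 + m2%:~R, b.2 + m2%:~R[)); last first.
  rewrite setTI; apply/seteqP; split => w /=;
  by rewrite /V /= !in_itv /= !ltrBrDr !ltrBlDr.
by apply: mT => //; apply: measurableX.
Qed.

(** By Fubini, it is enough to fix y. Near any x, choose a large k such that
    x + k gold ^ 2 is in the left half of the box modulo 1; on the interval of
    length 2 / k at the right of x, the first coordinate of T ^ k (x, y) hardly
    moves, while the second one makes two turns, and is between the sides of the
    box on a proportion of this interval that does not depend on k. *)
Lemma visits_ae a b K : a.1 < b.1 -> a.2 < b.2 -> leb2 R (~` visits a b K) = 0.
Proof.
move=> ab1 ab2; have mE := measurableC (measurable_visits a b K).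
transitivity ((mu \x^ mu)%E (~` visits a b K)).
  apply: (@product_measure_unique _ _ _ _ _ mu mu) => // A B mA mB.
  exact: product_measure2E.
apply: integral0_eq => y _ /=.
pose d := Num.min (b.2 - a.2) 1.
have d0 : 0 < d by rewrite lt_min subr_gt0 ab2 ltr01.
have d1 : d <= 1 by rewrite ge_min lexx orbT.
have d2 : d <= b.2 - a.2 by rewrite ge_min lexx.
apply: (@null_of_uniform_gaps _ _ (d / 2)); [exact: measurable_ysection|lra|].
move=> x e; rewrite /ysection /= => /set_mem Ex e0.
pose N := (Num.truncn (2 / e + 4 / (b.1 - a.1))).+1.
have [|k [m [Nk /andP[k1 k2]]]] := @rotation_dense R x a.1 ((a.1 + b.1) / 2) (maxn K N).
  by lra.
have Kk : (K <= k)%N by apply: leq_trans Nk; rewrite leq_maxl.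
have {}Nk : 2 / e + 4 / (b.1 - a.1) < k%:R.
  apply: lt_le_trans (truncnS_gt _) _; rewrite ler_nat; apply: leq_trans Nk.
  exact: leq_maxr.
have e20 : 0 < 2 / e by rewrite divr_gt0.
have e40 : 0 < 4 / (b.1 - a.1) by rewrite divr_gt0 // subr_gt0.
have k0 : 0 < k%:R :> R by lra.
have ke : 2 / k%:R < e by rewrite ltr_pdivrMr // mulrC -ltr_pdivrMr //; lra.
have kab : 2 / k%:R < (b.1 - a.1) / 2.
  rewrite ltr_pdivrMr //; have : 4 < k%:R * (b.1 - a.1).
    by rewrite -ltr_pdivrMr ?subr_gt0 //; lra.
  by rewrite [k%:R * _]mulrC; lra.
pose c := (iter k (@Tphi R) 0).2.
pose t := y + k%:R * x + c - a.2.
pose m2 := Num.floor t + 1.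
have t1 : t < m2%:~R by exact: floorD1_gt.
have t2 : m2%:~R <= t + 1 by rewrite intrD lerD2r floor_le.
exists (2 / k%:R), (x + (m2%:~R - t) / k%:R), (x + (m2%:~R - t + d) / k%:R).
have q1 : 0 < (m2%:~R - t) / k%:R by rewrite divr_gt0 // subr_gt0.
have q2 : (m2%:~R - t + d) / k%:R <= 2 / k%:R.
  by rewrite ler_pM2r ?invr_gt0 //; lra.
split.
- by rewrite ke divr_gt0.
- by have := divr_gt0 (ltr0n R 2) k0; lra.
- rewrite (_ : x + _ - _ = d / k%:R); last by ring.
  by rewrite mulrA divfK.
move=> x' /andP[l1 l2]; rewrite inE; apply; exists k, m, m2; split => //.
  by rewrite iter_TphiE /=; apply/andP; split; lra.
rewrite iter_TphiE /= -/c.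
have h1 : m2%:~R - t < (x' - x) * k%:R by rewrite -ltr_pdivrMr //; lra.
have h2 : (x' - x) * k%:R < m2%:~R - t + d by rewrite -ltr_pdivlMr //; lra.
by move: h1 h2; rewrite /t mulrBl [x' * _]mulrC [x * _]mulrC => h1 h2; apply/andP; split; lra.
Qed.

End visits.

(** * Measure of fundamental domains *)

Section fundamental_domains.
Variable R : realType.
Local Notation mu := (@lebesgue_measure R).

Lemma measurable_translation_line (c : R) :
  measurable_fun setT (fun x : measurableTypeR R => x + c : measurableTypeR R).
Proof. exact: measurable_funD. Qed.

Lemma lebesgue_measure_translation (c : R) (A : set (measurableTypeR R)) :
  measurable A -> mu ((fun x => x + c) @^-1` A) = mu A.
Proof.
move=> mA; apply/esym.
pose nu := measure_function_pushforward__canonical__measure_function_Measure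
  mu (measurable_translation_line c).
apply: (@lebesgue_measure_unique R nu _ A mA) => X [[a b] _ <-] /=.
rewrite /pushforward.
rewrite (_ : _ @^-1` _ = `]a - c, b - c]%classic); last first.
  by apply/seteqP; split => x /=; rewrite !in_itv /= ltrBlDr lerBrDr.
by rewrite !lebesgue_measure_itv /= !lte_fin ltrD2r; case: ifP => // _;
  rewrite -!EFinB; congr EFin; ring.
Qed.

Definition translate (v w : plane R) : plane R := w + v.

Lemma measurable_translation (v : plane R) :
  measurable_fun setT (translate v).
Proof.
by apply/measurable_fun_pairP; split => /=; apply: measurable_funD.
Qed.

Lemma leb2_translation (v : plane R) (A : set (plane R)) :
  measurable A -> leb2 R (translate v @^-1` A) = leb2 R A.
Proof.
move=> mA; apply/esym.
pose nu := measure_function_pushforward__canonical__measure_function_Measure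
  (leb2 R) (measurable_translation v).
suff H : forall B C, measurable B -> measurable C -> nu (B `*` C) = (mu B * mu C)%E.
  exact: (@product_measure_unique _ _ _ _ _ mu mu nu H).
move=> B C mB mC.
rewrite /nu /= /pushforward /leb2.
rewrite (_ : _ @^-1` _ =
  ((fun x => x + v.1) @^-1` B) `*` ((fun x => x + v.2) @^-1` C)) //.
rewrite product_measure1E.
- by congr (_ * _)%E; exact: lebesgue_measure_translation.
- by rewrite -[X in measurable X]setTI; exact: measurable_translation_line.
- by rewrite -[X in measurable X]setTI; exact: measurable_translation_line.
Qed.

Definition fundamental_domain (D : set (plane R)) : Prop :=
  [/\ measurable D, forall w, exists2 w', D w' & eqmodZ2 w w' &
      forall w w', D w -> D w' -> eqmodZ2 w w' -> w = w'].

Definition lattice_point (m : int * int) : plane R := (m.1%:~R, m.2%:~R).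

Lemma eqmod_lattice_point (w w' : plane R) :
  eqmodZ2 w w' <-> exists m, w = w' + lattice_point m.
Proof.
split=> [/eqmodZ2P[/intrP[m1 e1] /intrP[m2 e2]]|[m ->]].
  exists (m1, m2); rewrite [w]surjective_pairing; congr pair.
    by rewrite /lattice_point /= -e1 addrC subrK.
  by rewrite /lattice_point /= -e2 addrC subrK.
by apply/eqmodZ2P; rewrite /= !(addrC w'.1) !(addrC w'.2) !addrK !intr_int.
Qed.

Lemma lattice_point_inj : injective lattice_point.
Proof. by move=> [a b] [c d] [/intr_inj -> /intr_inj ->]. Qed.

(** Cut both domains along the translates of the other one; corresponding pieces
    are integer translates of one another. *)
Lemma fundamental_domain_measure D1 D2 (P : set (plane R)) :
  fundamental_domain D1 -> fundamental_domain D2 -> measurable P ->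
  (forall w w', eqmodZ2 w w' -> P w -> P w') ->
  leb2 R (D1 `&` P) = leb2 R (D2 `&` P).
Proof.
move=> [mD1 c1 i1] [mD2 c2 i2] mP perP.
pose F (k : nat) := [set w | (D1 `&` P) w /\
  exists2 m, pickle m = k & D2 (w + lattice_point m)].
pose G (k : nat) := [set w | (D2 `&` P) w /\
  exists2 m, pickle m = k & D1 (w - lattice_point m)].
have mT v (A : set (plane R)) : measurable A ->
    measurable (translate v @^-1` A).
  by move=> mA; rewrite -[X in measurable X]setTI; exact: measurable_translation.
have Pm w m : P (w + lattice_point m) <-> P w.
  have e : eqmodZ2 (w + lattice_point m) w by apply/eqmod_lattice_point; exists m.
  by split; apply: perP; rewrite // eqmodZ2_sym.
have GF k m : pickle m = k -> G k = translate (- lattice_point m) @^-1` F k.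
  move=> mk; apply/seteqP; split => w.
    move=> [[D2w Pw] [m' m'k D1w]]; have mm' : m' = m.
      by apply: (pcan_inj pickleK); rewrite m'k.
    subst m'; split; first by split => //; apply/(Pm _ m); rewrite subrK.
    by exists m => //; rewrite subrK.
  move=> [[D1w Pw] [m' m'k D2w]]; have mm' : m' = m.
    by apply: (pcan_inj pickleK); rewrite m'k.
  subst m'; move: D2w; rewrite subrK => D2w; split; last by exists m.
  by split => //; move/(Pm _ m): Pw; rewrite subrK.
have F0 k : ~ (exists m : int * int, pickle m = k) -> F k = set0 /\ G k = set0.
  by move=> nk; split; apply/seteqP; split => // w [_ [m mk _]]; apply: nk; exists m.
have mF k : measurable (F k).
  have [[m mk]|nk] := pselect (exists m : int * int, pickle m = k); last first.
    by have [-> _] := F0 _ nk.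
  rewrite (_ : F k = (D1 `&` P) `&` (translate (lattice_point m) @^-1` D2)).
    apply: measurableI; first exact: measurableI.
    by apply: mT.
  apply/seteqP; split => w [D1w].
    move=> [m' m'k D2w]; have mm' : m' = m.
      by apply: (pcan_inj pickleK); rewrite m'k.
    by subst m'.
  by move=> D2w; split => //; exists m.
have leFG k : leb2 R (G k) = leb2 R (F k).
  have [[m mk]|nk] := pselect (exists m : int * int, pickle m = k); last first.
    by have [-> ->] := F0 _ nk.
  by rewrite (GF _ _ mk) leb2_translation.
have mG k : measurable (G k).
  have [[m mk]|nk] := pselect (exists m : int * int, pickle m = k); last first.
    by have [_ ->] := F0 _ nk.
  by rewrite (GF _ _ mk); exact: mT.
have -> : D1 `&` P = \bigcup_k F k.
  apply/seteqP; split => [w [D1w Pw]|w [k _ [] //]].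
  have [w' D2w' +] := c2 w; rewrite eqmodZ2_sym => /eqmod_lattice_point [m w'E].
  by exists (pickle m) => //; split => //; exists m; rewrite -?w'E.
have -> : D2 `&` P = \bigcup_k G k.
  apply/seteqP; split => [w [D2w Pw]|w [k _ [] //]].
  have [w' D1w' /eqmod_lattice_point [m wE]] := c1 w.
  by exists (pickle m) => //; split => //; exists m; rewrite // wE addrK.
have tF : trivIset setT F.
  apply/trivIsetP => i j _ _ ij; apply/seteqP; split => // w.
  move=> [[_ [m mi D2w]] [_ [m' m'j D2w']]]; move/eqP: ij; apply.
  rewrite -mi -m'j; congr pickle; apply: lattice_point_inj.
  apply: (addrI w); apply: i2 => //; apply/eqmod_lattice_point.
  exists (m.1 - m'.1, m.2 - m'.2).
  by rewrite /lattice_point /= !rmorphB /= [w]surjective_pairing; congr pair => /=; ring.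
have tG : trivIset setT G.
  apply/trivIsetP => i j _ _ ij; apply/seteqP; split => // w.
  move=> [[_ [m mi D1w]] [_ [m' m'j D1w']]]; move/eqP: ij; apply.
  rewrite -mi -m'j; congr pickle; apply: lattice_point_inj; apply: oppr_inj.
  apply: (addrI w); apply: i1 => //; apply/eqmod_lattice_point.
  exists (m'.1 - m.1, m'.2 - m.2).
  by rewrite /lattice_point /= !rmorphB /= [w]surjective_pairing; congr pair => /=; ring.
rewrite (measure_semi_bigcup _ mF tF (bigcupT_measurable F mF)).
rewrite (measure_semi_bigcup _ mG tG (bigcupT_measurable G mG)).
by apply: eq_eseriesr => k _; rewrite leFG.
Qed.

Lemma unit_square_fundamental :
  fundamental_domain (`[0, 1[ `*` `[0, 1[ : set (plane R)).
Proof.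
split; first exact: measurableX.
- move=> w; exists (w.1 - (Num.floor w.1)%:~R, w.2 - (Num.floor w.2)%:~R).
    have fr (t : R) : 0 <= t - (Num.floor t)%:~R < 1.
      by have := floorD1_gt t; have := floor_le t; rewrite intrD => *;
        apply/andP; split; lra.
    by split; rewrite /= in_itv /=.
  by apply/eqmodZ2P; split; rewrite /= opprB addrC subrK intr_int.
- move=> w w' [/= + +] [/= + +]; rewrite !in_itv /= => a b c d /eqmodZ2P[e1 e2].
  by rewrite [w]surjective_pairing [w']surjective_pairing;
    congr pair; exact: eq_unit_interval.
Qed.

End fundamental_domains.

(** * Systems on a fundamental domain; measurability of the tower *)

Section torus_lift.
Variable R : realType.
Local Notation pi := (\pi_(torus R))%qT.

Lemma pi_eq (w w' : plane R) : pi w = pi w' <-> eqmodZ2 w w'.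
Proof. by split=> [/eqmodP|h] //; apply/eqmodP. Qed.

Lemma eqmod_repr (w : plane R) : eqmodZ2 (repr (pi w)) w.
Proof. by apply/pi_eq; rewrite reprK. Qed.

Lemma induced_Tphi (w : plane R) : induced_map (@Tphi R) (pi w) = pi (Tphi w).
Proof. by apply/pi_eq; rewrite eqmod_Tphi eqmod_repr. Qed.

Variable D : set (plane R).
Hypothesis fD : fundamental_domain D.

Definition torus_section (t : torus R) : plane R :=
  xget 0 [set w | D w /\ pi w = t].

Lemma torus_sectionP t : D (torus_section t) /\ pi (torus_section t) = t.
Proof.
have [_ c _] := fD; have [w Dw e] := c (repr t).
rewrite /torus_section; case: xgetP => [w' -> [] //|/(_ w)].
by case; split => //; rewrite -[RHS]reprK; apply/pi_eq; rewrite eqmodZ2_sym.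
Qed.

Lemma torus_section_pi w : D w -> torus_section (pi w) = w.
Proof.
have [_ _ i] := fD; have [Ds e] := torus_sectionP (pi w).
by move=> Dw; apply: i => //; apply/pi_eq.
Qed.

Lemma measurable_torus_section : measurable_fun setT torus_section.
Proof.
move=> _ B mB; rewrite setTI.
have [mD _ _] := fD.
suff H : pi @^-1` (torus_section @^-1` B) =
    \bigcup_m (translate (lattice_point R m) @^-1` (D `&` B)).
  suff : measurable (pi @^-1` (torus_section @^-1` B) : set (plane R)) by [].
  rewrite H; apply: countable_bigcupT_measurable => // m.
  rewrite -[X in measurable X]setTI; apply: measurable_translation => //.
  exact: measurableI.
apply/seteqP; split => w /=.
  have [Ds e] := torus_sectionP (pi w) => Bs.
  have /eqmod_lattice_point [m mE] : eqmodZ2 (torus_section (pi w)) w by apply/pi_eq.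
  by exists m => //=; rewrite /translate -mE.
move=> [m _ [/= Dw Bw]].
have -> : pi w = pi (translate (lattice_point R m) w).
  by apply/pi_eq; rewrite eqmodZ2_sym; apply/eqmod_lattice_point; exists m.
by rewrite torus_section_pi.
Qed.

Lemma torus_measureE (E : set (torus R)) : measurable E ->
  torus_measure E = leb2 R (D `&` pi @^-1` E).
Proof.
move=> mE; apply: fundamental_domain_measure => //.
  exact: unit_square_fundamental.
by move=> w w' /pi_eq /= ->.
Qed.

(** The projection to the torus is the isomorphism, and it is exact. *)
Lemma fundamental_domain_isomorphic (S : plane R -> plane R) :
  set_fun D D S -> (forall w, eqmodZ2 (S w) (Tphi w)) ->
  isomorphic_in_measure (leb2 R) D S (@torus_measure R) setT (induced_map (@Tphi R)).
Proof.
move=> SD ST; exists D, setT, (fun w => pi w), torus_section.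
have [mD _ _] := fD.
have neg0 d (X : measurableType d) (mu : set X -> \bar R) (A : set X) :
    mu set0 = 0%E -> mu.-negligible (A `\` A).
  by move=> mu0; exists set0; split => //; rewrite setDv.
split.
- by split => //; exact/neg0/measure0.
- split => //; apply: neg0.
  by rewrite /torus_measure preimage_set0 setI0 measure0.
- split => // [t _|w Dw|t _]; [by case: (torus_sectionP t)|exact: torus_section_pi|].
  by case: (torus_sectionP t).
- split => [|| E mE _].
  + by move=> _ E mE; apply: measurableI.
  + exact: measurable_torus_section.
  + by rewrite torus_measureE.
- by move=> w Dw; rewrite induced_Tphi; apply/pi_eq.
Qed.

End torus_lift.

Section measurable_tower.
Variables (R : realType) (n : nat).
Local Notation tower := (@tower R n).
Local Notation tower_piece := (@tower_piece R n).
Local Notation step := (@step R n).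

Lemma measurable_act u : measurable_fun setT (@act R u).
Proof.
apply/measurable_fun_pairP; split => /=; first exact: measurable_funD.
by apply: measurable_funD => //; apply: measurable_funD => //; exact: measurable_funM.
Qed.

Definition act_inv (u : seq bool) (w : plane R) : plane R :=
  (w.1 - disp R u, w.2 - (size u)%:R * (w.1 - disp R u) - offset R u).

Lemma actK u : cancel (@act R u) (act_inv u).
Proof. by case=> x y; rewrite /act /act_inv /=; congr pair; ring. Qed.

Lemma act_invK u : cancel (act_inv u) (@act R u).
Proof. by case=> x y; rewrite /act /act_inv /=; congr pair; ring. Qed.

Lemma measurable_act_inv u : measurable_fun setT (act_inv u).
Proof.
apply/measurable_fun_pairP; split => /=; first exact: measurable_funB.
apply: measurable_funB => //; apply: measurable_funB => //.
by apply: measurable_funM => //; exact: measurable_funB.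
Qed.

Lemma measurable_preimage d d' (X : measurableType d) (Y : measurableType d')
  (f : X -> Y) A : measurable_fun setT f -> measurable A -> measurable (f @^-1` A).
Proof. by move=> mf mA; rewrite -[X in measurable X]setTI; exact: mf. Qed.

Lemma measurable_cell b sw : measurable
  [set z | [/\ base n z, (0 <= z.1) = b & @swapped R n z = sw]].
Proof.
pose H : set (plane R) := fst @^-1` `[0, +oo[.
pose K : set (plane R) := act (block n.+1 b) @^-1` (snd @^-1` `[0, 1[).
pose B : set (plane R) :=
  (`[- right_len R n.+1, left_len R n.+1[ `*` `[0, 1[).
have -> : [set z | [/\ base n z, (0 <= z.1) = b & @swapped R n z = sw]] =
    B `&` ((if b then H else ~` H) `&` (if sw then ~` K else K)).
  apply/seteqP; split => z.
    move=> [bz bE swE]; split.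
      by move: bz; rewrite /base /B /= !in_itv /= => /andP.
    move: swE; rewrite /swapped /arrival bE => <-; split.
      by move: bE; case: (b) => bE; rewrite /H /= in_itv /= andbT bE.
    by case E: (0 <= (act (block n.+1 b) z).2 < 1); rewrite /K /= in_itv /= E.
  move=> [bz [hz kz]].
  have bE : (0 <= z.1) = b.
    move: hz; case: (b); rewrite /H /= in_itv /= andbT // => h.
    by apply/negbTE/negP.
  split => //; first by move: bz; rewrite /base /B /= !in_itv /= => /andP.
  rewrite /swapped /arrival bE; move: kz; case: sw => /=.
    by rewrite /K /= in_itv /= => /negP.
  by rewrite /K /= in_itv /= => ->.
have mH : measurable H by apply: measurable_preimage => //; exact: measurable_fst.
have mK : measurable K.
  apply: measurable_preimage; first exact: measurable_act.
  by apply: measurable_preimage => //; exact: measurable_snd.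
apply: measurableI; first exact: measurableX.
by apply: measurableI; [case: (b)|case: (sw)] => //; exact: measurableC.
Qed.

Lemma measurable_tower_piece c : measurable (tower_piece c).
Proof.
have -> : tower_piece c = \bigcup_(t : bool * bool) \bigcup_(j in
   [set j | (j < size (concat n (route t.1 t.2)))%N /\
            nth false (concat n (route t.1 t.2)) j = c])
   act_inv (take j (concat n (route t.1 t.2))) @^-1`
     [set z | [/\ base n z, (0 <= z.1) = t.1 & swapped n z = t.2]].
  apply/seteqP; split => w.
    move=> [z [j [bz js jc ->]]].
    exists (0 <= z.1, swapped n z) => //; exists j; first by split.
    have E : act_inv (take j (itinerary n z)) (position n z j) = z.
      by rewrite /position actK.
    suff : [set z' | [/\ base n z', (0 <= z'.1) = (0 <= z.1)
      & swapped n z' = swapped n z]] (act_inv (take j (itinerary n z)) (position n z j)).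
      by [].
    by rewrite E; split.
  move=> [[b sw] _ [j /= [js jc] [bz bE swE]]].
  exists (act_inv (take j (concat n (route b sw))) w), j.
  by rewrite /position /itinerary bE swE act_invK.
apply: countable_bigcupT_measurable => // -[b sw].
apply: bigcup_measurable => j _; apply: measurable_preimage.
  exact: measurable_act_inv.
exact: measurable_cell.
Qed.

Lemma measurable_tower : measurable tower.
Proof. by apply: measurableU; exact: measurable_tower_piece. Qed.

Lemma measurable_letter_at c : measurable [set w : plane R | letter_at n w = c].
Proof.
have mP := measurable_tower_piece true.
case: c.
  rewrite [X in measurable X](_ : _ = tower_piece true) //.
  by apply/seteqP; split => w /asboolP.
rewrite [X in measurable X](_ : _ = ~` tower_piece true); first exact: measurableC.
by apply/seteqP; split => w; [move=> /asboolP|move=> h; apply/asboolP].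
Qed.

Lemma measurable_step : measurable_fun setT step.
Proof.
move=> _ B mB; rewrite setTI.
rewrite [X in measurable X](_ : _ = \bigcup_(c : bool)
  ([set w : plane R | letter_at n w = c] `&` gen c @^-1` B)).
  apply: countable_bigcupT_measurable => // c; apply: measurableI.
    exact: measurable_letter_at.
  apply: measurable_preimage => //.
  have -> : @gen R c = act [:: c] by apply/funext => w; rewrite act_cons act0.
  exact: measurable_act.
apply/seteqP; split => w; first by move=> h; exists (letter_at n w).
by move=> [c _ [<-]].
Qed.

Lemma measurable_iter_step k : measurable_fun setT (iter k step).
Proof.
elim: k => [|k IH]; first exact: measurable_id.
exact: measurableT_comp measurable_step IH.
Qed.

Lemma measurable_code k c : measurable [set w : plane R | tower_code n w k = c].
Proof.
rewrite [X in measurable X](_ : _ =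
  iter k step @^-1` [set w : plane R | letter_at n w = c]) //.
by apply: measurable_preimage; [exact: measurable_iter_step|exact: measurable_letter_at].
Qed.

Lemma tower_fundamental : fundamental_domain tower.
Proof.
split; [exact: measurable_tower|exact: tower_cover|].
by move=> w w'; exact: tower_inj.
Qed.

Lemma eqmod_step w : eqmodZ2 (step w) (Tphi w).
Proof. exact: eqmod_gen. Qed.

End measurable_tower.

(** * Generic points of the tower *)

Section decoding.
Variables (R : realType) (n : nat).
Local Notation tower := (@tower R n).
Local Notation step := (@step R n).

Definition dense_orbit : set (plane R) :=
  [set w | forall (q : rat * rat) (j K : nat),
     visits (ratr q.1, ratr q.2) (ratr q.1 + j.+1%:R^-1, ratr q.2 + j.+1%:R^-1) K w].

Definition generic : set (plane R) := tower `&` dense_orbit.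

Lemma dense_orbitE : dense_orbit = \bigcap_(i : (rat * rat) * nat * nat)
  visits (ratr i.1.1.1, ratr i.1.1.2)
    (ratr i.1.1.1 + i.1.2.+1%:R^-1, ratr i.1.1.2 + i.1.2.+1%:R^-1) i.2.
Proof.
apply/seteqP; split => w; first by move=> dw [[q j] K] _; exact: dw.
by move=> dw q j K; exact: (dw (q, j, K)).
Qed.

Lemma not_dense_orbitE : ~` dense_orbit = \bigcup_(i : (rat * rat) * nat * nat)
  ~` visits (ratr i.1.1.1, ratr i.1.1.2)
    (ratr i.1.1.1 + i.1.2.+1%:R^-1, ratr i.1.1.2 + i.1.2.+1%:R^-1) i.2.
Proof. by rewrite dense_orbitE setC_bigcap. Qed.

Lemma measurable_dense_orbit : measurable dense_orbit.
Proof.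
rewrite -[dense_orbit]setCK not_dense_orbitE; apply: measurableC.
apply: countable_bigcupT_measurable => // i; apply: measurableC.
exact: measurable_visits.
Qed.

Lemma dense_orbit_ae : leb2 R (~` dense_orbit) = 0%E.
Proof.
have V0 (i : (rat * rat) * nat * nat) : leb2 R (~` visits (ratr i.1.1.1, ratr i.1.1.2)
    (ratr i.1.1.1 + i.1.2.+1%:R^-1, ratr i.1.1.2 + i.1.2.+1%:R^-1) i.2) = 0%E.
  by apply: visits_ae; rewrite /= ltrDl.
pose F k := if unpickle k is Some i then
  ~` @visits R (ratr i.1.1.1, ratr i.1.1.2)
    (ratr i.1.1.1 + i.1.2.+1%:R^-1, ratr i.1.1.2 + i.1.2.+1%:R^-1) i.2 else set0.
have mF k : measurable (F k).
  by rewrite /F; case: unpickle => // i; apply: measurableC; exact: measurable_visits.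
have sub : ~` dense_orbit `<=` \bigcup_k F k.
  rewrite not_dense_orbitE => w [i _ iw]; exists (pickle i); first exact: I.
  by rewrite /F pickleK.
apply/eqP; rewrite -measure_le0.
apply: le_trans (measure_sigma_subadditive _ mF _ sub) _.
  exact: measurableC measurable_dense_orbit.
rewrite eseries0 // => k _ _; rewrite /F; case: unpickle => [i|]; first exact: V0.
exact: measure0.
Qed.

Lemma measurable_generic : measurable generic.
Proof. exact: measurableI (@measurable_tower R n) measurable_dense_orbit. Qed.

Lemma generic_ae (X : set (plane R)) :
  measurable X -> X `<=` ~` generic -> X `<=` tower ->
  leb2 R X = 0%E.
Proof.
move=> mX Xg Xt; apply/eqP; rewrite -measure_le0 -dense_orbit_ae; apply: le_measure.
- by rewrite inE.
- by rewrite inE; exact: measurableC measurable_dense_orbit.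
- by move=> w Xw dw; apply: (Xg w Xw); split => //; exact: Xt.
Qed.

Lemma generic_step w : generic w -> generic (step w).
Proof.
move=> [tw dw]; split; first exact: step_tower.
move=> q j K; have [k [m1 [m2 [Kk h1 h2]]]] := dw q j K.+1.
have /eqmodZ2P : eqmodZ2 (iter k.-1 (@Tphi R) (step w)) (iter k (@Tphi R) w).
  rewrite -[X in eqmodZ2 _ (iter X _ _)](prednK (leq_ltn_trans (leq0n K) Kk)).
  by rewrite iterSr eqmod_iter_Tphi eqmod_step.
case=> /intrP[a1 e1] /intrP[a2 e2].
exists k.-1, (m1 + a1), (m2 + a2); split.
- by move: Kk; lia.
- rewrite intrD -e1 (_ : _ - _ = (iter k (@Tphi R) w).1 - m1%:~R) //; ring.
- rewrite intrD -e2 (_ : _ - _ = (iter k (@Tphi R) w).2 - m2%:~R) //; ring.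
Qed.

(** The orbit of w enters the small square above and to the right of the point of
    the base below w', and then follows the same itinerary, which preserves the
    order of both coordinates. *)
Lemma generic_dominates w w' : generic w -> tower w' ->
  exists k, w'.1 <= (iter k step w).1 /\ w'.2 <= (iter k step w).2.
Proof.
move=> [tw dw] /towerP[z [j [bz js ->]]].
have [d d0 dz] := itinerary_stable bz.
have rat_near (t : R) : exists q : rat, t < ratr q < t + d / 2.
  have [|q] := @rat_in_itvoo R t (t + d / 2); first by lra.
  by rewrite in_itv /=; exists q.
have [q1 /andP[a1 a2]] := rat_near z.1.
have [q2 /andP[b1 b2]] := rat_near z.2.
pose i := Num.truncn (2 / d).
have ei : i.+1%:R^-1 < d / 2.
  by rewrite -[d / 2]invrK ltf_pV2 ?posrE ?invr_gt0 ?divr_gt0 // invf_div truncnS_gt.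
have [k [m1 [m2 [_ /andP[u1 u2] /andP[v1 v2]]]]] := dw (q1, q2) i 0%N.
have {}u1 : ratr q1 < (iter k (@Tphi R) w).1 - m1%:~R := u1.
have {}u2 : (iter k (@Tphi R) w).1 - m1%:~R < ratr q1 + i.+1%:R^-1 := u2.
have {}v1 : ratr q2 < (iter k (@Tphi R) w).2 - m2%:~R := v1.
have {}v2 : (iter k (@Tphi R) w).2 - m2%:~R < ratr q2 + i.+1%:R^-1 := v2.
clearbody i.
pose y : plane R :=
  ((iter k (@Tphi R) w).1 - m1%:~R, (iter k (@Tphi R) w).2 - m2%:~R).
have [|| byy iy] := dz y.
- apply/andP; split; first by apply: ltW; exact: lt_trans u1.
  apply: (lt_trans u2); apply: (lt_le_trans (ltrD a2 ei)).
  by rewrite -addrA -splitr.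
- apply/andP; split; first by apply: ltW; exact: lt_trans v1.
  apply: (lt_trans v2); apply: (lt_le_trans (ltrD b2 ei)).
  by rewrite -addrA -splitr.
have wy : iter k step w = y.
  apply: (@tower_inj R n); [exact: iter_step_tower|exact: base_tower|].
  apply: eqmodZ2_trans (eqmod_iter_step _ _ _) _.
  by apply/eqmod_lattice_point; exists (m1, m2);
    rewrite [LHS]surjective_pairing; congr pair; rewrite /= subrK.
exists (j + k)%N; rewrite iterD wy iter_step_base ?iy ?(ltnW js) //.
rewrite /position iy /act /=.
have y1 : z.1 <= y.1 by rewrite /y /=; lra.
have y2 : z.2 <= y.2 by rewrite /y /=; lra.
(* The shear y + j x is increasing in x. *)
by rewrite !lerD2r y1 lerD // ler_wpM2l.
Qed.

End decoding.

(** * The exchange of two pieces and the decoding of its sequences *)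

Section tower_bounds.
Variables (R : realType) (n : nat).
Local Notation tower := (@tower R n).
Local Notation step := (@step R n).

Lemma slide_le1 c : `|slide R c| <= 1.
Proof.
have /andP[g0 g1] := gold_bounds R.
by rewrite /slide; case: c; rewrite ler_norml; apply/andP; split=> /=; lra.
Qed.

Lemma disp_le u : `|disp R u| <= (size u)%:R.
Proof.
elim: u => [|c u IH] /=; first by rewrite normr0.
rewrite -natr1 addrC; apply: le_trans (ler_normD _ _) _.
by rewrite lerD // slide_le1.
Qed.

Lemma offset_le u : `|offset R u| <= (size u)%:R * (2 + (size u)%:R).
Proof.
have /andP[g0 g1] := gold_bounds R.
have rise2 c : `|rise R c| <= 2.
  by rewrite /rise; case: c; rewrite ?expr1 ?expr0 ler_norml; apply/andP; split; lra.
elim: u => [|c u IH] /=; first by rewrite normr0 mul0r.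
rewrite -natr1; apply: le_trans (ler_normD _ _) _.
have h1 : `|rise R c + (size u)%:R * slide R c| <= 2 + (size u)%:R.
  apply: le_trans (ler_normD _ _) _; apply: lerD => //.
  by rewrite normrM normr_nat ler_piMr ?slide_le1.
apply: le_trans (lerD h1 IH) _.
have : 0 <= (size u)%:R :> R by [].
by move: ((size u)%:R : R) => t t0; nra.
Qed.

Lemma tower_bounded : exists C : R, forall w, tower w -> `|w.1| <= C /\ `|w.2| <= C.
Proof.
pose p := (size (block n.+1 false))%:R : R.
exists (1 + p + (1 + p + p * (2 + p))) => w /towerP[z [j [bz js ->]]].
have p0 : 0 <= p by [].
have zb : `|z.1| <= 1 /\ `|z.2| <= 1.
  move: bz => /andP[/andP[x1 x2] /andP[y1 y2]].
  have [s0 sr _ q1 [qp [qE ar]]] := tower_params R n.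
  have r1 : right_len R n.+1 <= 1.
    have : 0 <= (sizeF R n.+1 - 1) * right_len R n.+1 by rewrite mulr_ge0 //; lra.
    have : 0 <= sizeT R n.+1 * left_len R n.+1 by rewrite mulr_ge0 //; lra.
    by lra.
  by split; rewrite ler_norml; apply/andP; split; lra.
have jp : j%:R <= p.
  rewrite ler_nat; apply: leq_trans (ltnW js) _; rewrite size_itinerary.
  by case: (_ <= _); rewrite // ltnW // size_block_lt.
have szE : size (take j (itinerary n z)) = j by rewrite size_takel // ltnW.
have d1 := disp_le (take j (itinerary n z)).
have o1 := offset_le (take j (itinerary n z)).
rewrite szE in d1 o1.
have j0 : 0 <= j%:R :> R by [].
have o2 : j%:R * (2 + j%:R) <= p * (2 + p) :> R by rewrite ler_pM ?addr_ge0 ?lerD2l.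
have pp0 : 0 <= p * (2 + p) by rewrite mulr_ge0 ?addr_ge0.
rewrite /position /act /= szE; split.
  by apply: le_trans (ler_normD _ _) _; lra.
apply: le_trans (ler_normD _ _) _.
have := ler_normD z.2 (j%:R * z.1); rewrite normrM normr_nat.
have : j%:R * `|z.1| <= p by rewrite -[leRHS]mulr1 ler_pM //; case: zb.
by case: zb => *; lra.
Qed.

Definition extent (f : plane R -> R) : R := sup [set f w | w in tower].

Lemma origin_tower : tower 0.
Proof.
apply: base_tower; have r0 := right_len_gt0 R n.+1; have s0 := left_len_gt0 R n.+1.
by rewrite /base /=; apply/andP; split; apply/andP; split; lra.
Qed.

(** The supremum of a coordinate f along a generic orbit does not depend on the
    orbit, hence f w can be read off the displacements u. *)
Lemma sups_orbit (f : plane R -> R) (u : nat -> R) w :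
  (exists C, forall w', tower w' -> f w' <= C) -> tower w ->
  (forall w', tower w' -> exists k, f w' <= f (iter k step w)) ->
  (forall k, f (iter k step w) = f w + u k) ->
  sups u 0 = extent f - f w.
Proof.
move=> [C fC] tw dom uE.
have hs : has_sup [set f w | w in tower].
  split; first by exists (f 0), 0 => //; exact: origin_tower.
  by exists C => _ [w' tw' <-]; exact: fC.
have ub k : u k <= extent f - f w.
  rewrite lerBrDl -uE; apply: sup_upper_bound => //.
  by exists (iter k step w) => //; exact: iter_step_tower.
have hu : has_sup [set u k | k in [set k | (0 <= k)%N]].
  by split; [exists (u 0%N), 0%N|exists (extent f - f w) => _ [k _ <-]].
apply/eqP; rewrite eq_le; apply/andP; split.
  by apply: ge_sup; [case: hu|move=> _ [k _ <-]].
rewrite lerBlDl; apply: ge_sup; first by case: hs.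
move=> _ [w' tw' <-]; have [k fk] := dom w' tw'.
apply: le_trans fk _; rewrite uE lerD2l; apply: sup_upper_bound => //.
by exists k.
Qed.

End tower_bounds.

Section golden_exchange.
Variables (R : realType) (n : nat).
Local Notation tower := (@tower R n).
Local Notation step := (@step R n).

(** Letter 0 is the piece on which the map is T - (0, -1), letter 1 the piece on
    which it is T - (1, 1). *)
Definition golden_exchange : exchange R :=
  @Exchange R 1 tower step (fun i => tower_piece n (i == ord_max)).

Local Notation E := golden_exchange.

Definition to_letter (c : bool) : letter E := if c then ord_max else ord0.
Definition of_letter (i : letter E) : bool := i == ord_max.

Lemma to_letterK : cancel to_letter of_letter.
Proof. by case. Qed.

Lemma of_letterK : cancel of_letter to_letter.
Proof. by case=> -[|[|//]] h; apply/val_inj. Qed.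

Definition coding (w : plane R) : letter_seq E :=
  fun k => to_letter (tower_code n w k).

Lemma codesP w s : tower w -> codes w s <-> s = coding w.
Proof.
move=> tw; have tk k : tower (iter k step w) by exact: iter_step_tower.
split=> [h|-> k i].
  apply/funext => k; apply/(h k); rewrite /piece /=.
  rewrite -/(of_letter _) to_letterK; exact: tower_letter_at (tk k).
rewrite /= -/(of_letter i); split=> [/letter_atP e|<-].
  by rewrite /coding /tower_code e of_letterK.
by rewrite to_letterK; exact: tower_letter_at (tk k).
Qed.

Lemma measurable_coord k i : measurable [set s : letter_seq E | s k = i].
Proof. by apply: sub_sigma_algebra; exists k, i. Qed.

Lemma measurable_coding : measurable_fun setT coding.
Proof.
apply: (@measurability _ _ _ _ setT coding (@cylinders R E) erefl) => //.
move=> _ [_ [k [i ->]] <-].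
rewrite setTI (_ : _ @^-1` _ = [set w : plane R | tower_code n w k = of_letter i]).
  exact: measurable_code.
apply/seteqP; split => w /=; rewrite /coding => h.
  by rewrite -[LHS]to_letterK h.
by rewrite h of_letterK.
Qed.

Lemma coding_step w : coding (step w) = Defs.shift (coding w).
Proof. by apply/funext => k; rewrite /coding /Defs.shift /tower_code iterSr. Qed.

Lemma symbolic_spaceE : symbolic_space (E := E) = coding @` tower.
Proof.
apply/seteqP; split => s.
  by move=> [w tw /(codesP _ tw) ->]; exists w.
by move=> [w tw <-]; exists w => //; exact/(codesP _ tw).
Qed.

Lemma symbolic_measureE B : measurable B ->
  symbolic_measure (E := E) B = leb2 R (tower `&` coding @^-1` B).
Proof.
move=> mB; rewrite /symbolic_measure -measurable_mu_extE.
  congr (_^* _)%mu; apply/seteqP; split => w.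
    by move=> [tw [s /(codesP _ tw) ->]].
  by move=> [tw Bw]; split => //; exists (coding w) => //; exact/(codesP _ tw).
apply: measurableI; first exact: measurable_tower.
by apply: measurable_preimage => //; exact: measurable_coding.
Qed.

Lemma iter_step_act k w :
  iter k step w = act (mkseq (tower_code n w) k) w.
Proof.
elim: k => [|k IH]; first by rewrite act0.
by rewrite mkseqS -cats1 act_cat -IH act_cons act0.
Qed.

Definition word (s : letter_seq E) k : seq bool := mkseq (of_letter \o s) k.

Lemma word_coding w k : word (coding w) k = mkseq (tower_code n w) k.
Proof. by apply: eq_mkseq => i; rewrite /= to_letterK. Qed.

(** The coding of w determines its displacements along the orbit. This gives w.1
    by sups_orbit, then w.2, since the vertical displacement after k steps is
    k w.1 plus a function of the coding. *)
Definition decode1 s : R :=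
  extent n fst - sups (fun k => disp R (word s k)) 0.
Definition decode2 s : R :=
  extent n snd - sups (fun k => k%:R * decode1 s + offset R (word s k)) 0.
Definition decode s : plane R := (decode1 s, decode2 s).

(** The sequences for which both suprema are finite: elsewhere the decoding
    is a default value without meaning. *)
Definition decodable : set (letter_seq E) :=
  [set s | exists C : nat, forall k, disp R (word s k) <= C%:R] `&`
  [set s | exists C : nat, forall k, k%:R * decode1 s + offset R (word s k) <= C%:R].

Lemma decode_coding w : generic n w -> decode (coding w) = w /\ decodable (coding w).
Proof.
move=> gw; have tw : tower w by case: gw.
have [C bC] := tower_bounded R n.
have tk k : tower (iter k step w) by exact: iter_step_tower.
have e1 k : (iter k step w).1 = w.1 + disp R (word (coding w) k).
  by rewrite iter_step_act word_coding.
have d1 : decode1 (coding w) = w.1.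
  rewrite /decode1 (@sups_orbit R n fst _ w) ?subKr //.
    by exists C => w' /bC[+ _] => /(le_trans (ler_norm _)).
  by move=> w' tw'; have [k []] := generic_dominates gw tw'; exists k.
have e2 k : (iter k step w).2 =
    w.2 + (k%:R * decode1 (coding w) + offset R (word (coding w) k)).
  by rewrite d1 iter_step_act word_coding /act /= size_mkseq addrA.
have d2 : decode2 (coding w) = w.2.
  rewrite /decode2 (@sups_orbit R n snd _ w) ?subKr //.
    by exists C => w' /bC[_ +] => /(le_trans (ler_norm _)).
  by move=> w' tw'; have [k []] := generic_dominates gw tw'; exists k.
split; first by rewrite /decode d1 d2 -surjective_pairing.
have ex (a : nat -> R) (b : R) : (forall k, `|b + a k| <= C) -> `|b| <= C ->
    exists N : nat, forall k, a k <= N%:R.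
  move=> h hb; exists (Num.truncn (C + C)).+1 => k.
  apply: le_trans (ltW (truncnS_gt _)).
  by move: (h k) hb; rewrite !ler_norml => /andP[_ h1] /andP[h2 _]; lra.
split.
  apply: (ex _ w.1); last by have [] := bC w tw.
  by move=> k; rewrite -e1; have [] := bC _ (tk k).
apply: (ex _ w.2); last by have [] := bC w tw.
by move=> k; rewrite -e2; have [] := bC _ (tk k).
Qed.

End golden_exchange.

(** * Conjugacy of the symbolic system with the torus *)

Lemma measurable_fun_pair_on d d1 d2 (X : measurableType d)
    (X1 : measurableType d1) (X2 : measurableType d2) (D : set X)
    (f : X -> X1) (g : X -> X2) :
  measurable_fun D f -> measurable_fun D g ->
  measurable_fun D (fun x => (f x, g x)).
Proof.
move=> mf mg mD; move: (mD); apply: (@measurability _ _ _ _ _ _ _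
  (measurable_prod_measurableType X1 X2)) => _ [_ [A mA [B mB <-]] <-].
rewrite (_ : _ `&` _ = (D `&` f @^-1` A) `&` (D `&` g @^-1` B)).
  by apply: measurableI; [exact: mf|exact: mg].
by apply/seteqP; split=> [x [Dx []]|x [[Dx ?] []]].
Qed.

Section symbolic_isomorphism.
Variables (R : realType) (n : nat).
Local Notation tower := (@tower R n).
Local Notation step := (@step R n).
Local Notation E := (golden_exchange R n).
Local Notation pi := (\pi_(torus R))%qT.

Lemma of_letter_indic k : (fun s : letter_seq E => (of_letter (s k))%:R : R) =
  \1_[set s : letter_seq E | s k = ord_max].
Proof.
apply/funext => s; rewrite indicE /of_letter; congr (_%:R); congr nat_of_bool.
by apply/eqP/idP => [h|/set_mem]; [exact: mem_set|].
Qed.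

Lemma measurable_of_letter k :
  measurable_fun setT (fun s : letter_seq E => (of_letter (s k))%:R : measurableTypeR R).
Proof.
by rewrite of_letter_indic; apply: measurable_indic; exact: measurable_coord.
Qed.

Lemma measurable_disp_word k :
  measurable_fun setT (fun s : letter_seq E => disp R (word s k) : measurableTypeR R).
Proof.
elim: k => [|k IH]; first exact: measurable_cst.
rewrite (_ : (fun s : letter_seq E => _) = (fun s => disp R (word s k) +
    (1 - gold R - (of_letter (s k))%:R))); last first.
  by apply/funext => s; rewrite /word mkseqS -cats1 disp_cat /= addr0.
apply: measurable_funD => //; apply: measurable_funB => //.
exact: measurable_of_letter.
Qed.

Lemma measurable_offset_word k :
  measurable_fun setT (fun s : letter_seq E => offset R (word s k) : measurableTypeR R).
Proof.
elim: k => [|k IH]; first exact: measurable_cst.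
rewrite (_ : (fun s : letter_seq E => _) = (fun s => offset R (word s k) +
    (1 - (of_letter (s k))%:R * 2 - (2 * gold R - 1) / 2) + disp R (word s k)));
    last first.
  apply/funext => s; rewrite /word mkseqS -cats1 offset_cat /= mul0r !addr0 mul1r.
  congr (_ + _ + _); rewrite /rise; congr (_ - _).
  by case: (of_letter _); rewrite ?expr1 ?expr0 ?mul1r ?mul0r ?subr0 //; ring.
apply: measurable_funD; last exact: measurable_disp_word.
apply: measurable_funD => //; apply: measurable_funB => //.
apply: measurable_funB => //; apply: measurable_funM => //.
exact: measurable_of_letter.
Qed.

Definition bounded_disp : set (letter_seq E) :=
  [set s | exists C : nat, forall k, disp R (word s k) <= C%:R].

Lemma measurable_bounded_above (u : nat -> letter_seq E -> measurableTypeR R)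
    (D : set (letter_seq E)) :
  measurable D -> (forall k, measurable_fun D (u k)) ->
  measurable (D `&` [set s | exists C : nat, forall k, u k s <= C%:R]).
Proof.
move=> mD mu.
rewrite (_ : _ `&` _ = \bigcup_(C : nat) \bigcap_(k : nat)
    (D `&` u k @^-1` `]-oo, C%:R])); last first.
  apply/seteqP; split => s.
    by move=> [Ds [C sC]]; exists C => // k _; split; rewrite //= in_itv /= sC.
  move=> [C _ sC]; split; first by have [] := sC 0%N I.
  by exists C => k; have [_] := sC k I; rewrite /= in_itv.
apply: bigcup_measurable => C _; apply: bigcapT_measurable => k.
by apply: mu.
Qed.

Lemma measurable_bounded_disp : measurable bounded_disp.
Proof.
rewrite -[bounded_disp]setTI; apply: measurable_bounded_above => // k.
exact: measurable_disp_word.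
Qed.

Lemma measurable_decode1 :
  measurable_fun bounded_disp (@decode1 R n : letter_seq E -> measurableTypeR R).
Proof.
apply: measurable_funB => //.
apply: (@measurable_fun_sups _ _ R _ (fun k s => disp R (word s k))).
  by move=> s [C sC]; exists C%:R => _ [k _ <-].
by move=> k; apply: measurable_funTS; exact: measurable_disp_word.
Qed.

Lemma measurable_height k : measurable_fun bounded_disp
  (fun s : letter_seq E => k%:R * decode1 s + offset R (word s k) : measurableTypeR R).
Proof.
apply: measurable_funD.
  by apply: measurable_funM => //; exact: measurable_decode1.
by apply: measurable_funTS; exact: measurable_offset_word.
Qed.

Lemma measurable_decodable : measurable (@decodable R n).
Proof.
apply: (measurable_bounded_above measurable_bounded_disp) => k.
exact: measurable_height.
Qed.

Lemma measurable_decode : measurable_fun (@decodable R n) (@decode R n).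
Proof.
have sub : @decodable R n `<=` bounded_disp by move=> s [].
apply: measurable_fun_pair_on.
  exact: measurable_funS measurable_bounded_disp sub measurable_decode1.
apply: measurable_funB => //.
apply: (@measurable_fun_sups _ _ R _
  (fun k s => k%:R * decode1 s + offset R (word s k))).
  by move=> s [_ [C sC]]; exists C%:R => _ [k _ <-].
by move=> k; exact: measurable_funS measurable_bounded_disp sub (measurable_height k).
Qed.

Definition generic_codings : set (letter_seq E) := coding n @` generic n.

(** The explicit decoding makes the image of the coding measurable. *)
Lemma generic_codingsE : generic_codings =
  (@decodable R n `&` @decode R n @^-1` generic n) `&`
  \bigcap_k \bigcup_(i : letter E)
    ((@decodable R n `&` @decode R n @^-1`
       [set w | tower_code n w k = of_letter i]) `&` [set s | s k = i]).
Proof.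
apply/seteqP; split => s.
  move=> [w gw <-]; have [dw cw] := decode_coding gw.
  split; first by split; rewrite //= dw.
  move=> k _; exists (coding n w k) => //; split => //; split => //=.
  by rewrite dw /coding to_letterK.
move=> [[cs gs] sk]; exists (decode s) => //.
apply/funext => k; have [i _ [[_ /= ki] si]] := sk k I.
by rewrite /coding ki of_letterK si.
Qed.

Lemma measurable_generic_codings : measurable generic_codings.
Proof.
have md A : measurable A -> measurable (@decodable R n `&` @decode R n @^-1` A).
  by move=> mA; apply: measurable_decode => //; exact: measurable_decodable.
rewrite generic_codingsE; apply: measurableI; first by apply: md; exact: measurable_generic.
apply: bigcapT_measurable => k; apply: countable_bigcupT_measurable => // i; apply: measurableI.
  by apply: md; exact: measurable_code.
exact: measurable_coord.
Qed.

Lemma golden_exchange_adapted : adapted (@Tphi R) E.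
Proof.
split; first by move=> w; exact: step_tower.
split.
- apply: fundamental_domain_isomorphic; first exact: tower_fundamental.
    by move=> w; exact: step_tower.
  exact: eqmod_step.
- split.
  + apply/seteqP; split => w.
      case=> tw; [exists ord0|exists ord_max] => //=.
    by case=> i _ /=; case: (i == ord_max) => tw; [right|left].
  + move=> i; exists (tower_piece n (i == ord_max)).
      exact: measurable_tower_piece.
    by exists set0; [exact: negligible_set0|rewrite setU0].
  + move=> i j ij; rewrite [X in _.-negligible X](_ : _ = set0).
      exact: negligible_set0.
    apply/seteqP; split => // w /= [wi wj].
    have : of_letter i = of_letter j by rewrite /of_letter -(letter_atP wi) -(letter_atP wj).
    by move=> /(can_inj (@of_letterK R n)) e; rewrite e eqxx in ij.
- rewrite [X in _.-negligible X](_ : _ = set0); first exact: negligible_set0.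
  apply/seteqP; split => // w [/= tw [y [ty yw wy]]].
  by move/eqP: yw; apply; apply/esym; exact: (tower_inj tw ty wy).
- exists (fun i => lattice_shift R (i == ord_max)).
    by move=> i; exact: lattice_shift_Z2.
  by move=> w i _ /= wi; rewrite -genE /step (letter_atP wi).
Qed.

(** The isomorphism sends a coding to the class of the decoded point. *)
Lemma golden_exchange_conjugate : conjugate_to (@Tphi R) E.
Proof.
split; first exact: golden_exchange_adapted.
have fD := tower_fundamental R n.
pose B' : set (torus R) := torus_section tower @^-1` generic n.
have mB' : measurable B'.
  by apply: measurable_preimage; [exact: measurable_torus_section|exact: measurable_generic].
have mA' := measurable_generic_codings.
have mcod A : measurable A -> measurable (coding n @^-1` A).
  by move=> mA; apply: measurable_preimage => //; exact: measurable_coding.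
have mpi (A : set (torus R)) : measurable A -> measurable (pi @^-1` A : set (plane R)) by [].
have mt := @measurable_tower R n.
have sg w : generic n w -> torus_section tower (pi w) = w.
  by case=> tw _; exact: torus_section_pi.
exists generic_codings, B', (fun s => pi (decode s)),
  (fun t => coding n (torus_section tower t)).
split.
- split => //.
  + by move=> s [w [tw _] <-]; rewrite symbolic_spaceE; exists w.
  + exists (~` generic_codings); split; first exact: measurableC.
      rewrite symbolic_measureE; last exact: measurableC.
      apply: (@generic_ae R n).
        by apply: measurableI => //; apply: mcod; exact: measurableC.
        by move=> w [_ nw] gw; apply: (nw : ~ generic_codings (coding n w)); exists w.
      by move=> w [].
    by move=> s [].
  + move=> s [w gw <-]; rewrite -coding_step.
    by exists (step w) => //; exact: generic_step.
- split => //.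
  + exists (~` B'); split; [exact: measurableC| |by move=> t []].
    rewrite (torus_measureE fD); last exact: measurableC.
    apply: (@generic_ae R n).
    * by apply: measurableI => //; apply: mpi; exact: measurableC.
    * by move=> w [tw nw] gw; apply: nw; rewrite /B' /= sg.
    * by move=> w [].
  + move=> t Bt; have [_ e] := torus_sectionP fD t.
    rewrite /B' /= -{1}e induced_Tphi.
    have -> : pi (Tphi (torus_section tower t)) = pi (step (torus_section tower t)).
      by apply/pi_eq; rewrite eqmodZ2_sym eqmod_step.
    by rewrite sg; exact: generic_step.
- split.
  + by move=> s [w gw <-]; have [-> _] := decode_coding gw; rewrite /B' /= sg.
  + by move=> t Bt; exists (torus_section tower t).
  + by move=> s [w gw <-]; have [-> _] := decode_coding gw; rewrite sg.
  + by move=> t Bt; have [-> _] := decode_coding Bt; have [] := torus_sectionP fD t.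
- have subA : generic_codings `<=` @decodable R n.
    by move=> s [w gw <-]; have [] := decode_coding gw.
  split.
  + have md := measurable_funS (@measurable_decodable) subA measurable_decode.
    by move=> mA A mm; exact: (md mA _ (mpi _ mm)).
  + apply: measurable_funTS; apply: measurableT_comp; first exact: measurable_coding.
    exact: measurable_torus_section.
  + move=> A mA AB.
    have mF : measurable (generic_codings `&` (fun s => pi (decode s)) @^-1` A).
      have md := measurable_funS measurable_decodable subA measurable_decode.
      exact: (md mA' _ (mpi _ mA)).
    rewrite symbolic_measureE // (torus_measureE fD) //.
    set F := tower `&` _; set G := tower `&` _.
    have mF' : measurable F by apply: measurableI => //; exact: mcod.
    have mG' : measurable G by apply: measurableI => //; exact: mpi.
    (* A point of F outside G has the coding of another point, which is generic;
       it is not generic itself, by decode_coding. *)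
    have GF : G `<=` F.
      move=> w [tw Aw]; have gw : generic n w.
        by have := AB _ Aw; rewrite /B' /= torus_section_pi.
      split => //; split; first by exists w.
      by rewrite /preimage /=; have [-> _] := decode_coding gw.
    rewrite -(setDUK GF) measureU0 //; first exact: measurableD.
    apply: (@generic_ae R n); first exact: measurableD; last by move=> w [[]].
    move=> w [[tw [_ Aw]] nG] gw; apply: nG; split => //.
    by move: Aw; rewrite /preimage /=; have [-> _] := decode_coding gw.
- move=> s [w gw <-]; rewrite -coding_step.
  have [-> _] := decode_coding gw; have [-> _] := decode_coding (generic_step gw).
  by rewrite induced_Tphi; apply/pi_eq; exact: eqmod_step.
Qed.

End symbolic_isomorphism.

(** * Complexity *)

Section complexity_lower_bound.
Variables (R : realType) (E : exchange R).
Hypothesis cE : conjugate_to (@Tphi R) E.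
Local Notation pi := (\pi_(torus R))%qT.
Local Notation S := (symbolic_space (E := E)).
Local Notation word_set k := [set w : k.-tuple (letter E) | `[< language w >]]%SET.

Definition prefix_of (s : letter_seq E) k : k.-tuple (letter E) :=
  [tuple s i | i < k].

Lemma symbolic_space_shift s : S s -> S (Defs.shift s).
Proof.
have [[dE _] _] := cE.
move=> [x Dx xs]; exists (emap E x); first exact: dE.
by move=> k i; rewrite -iterSr; exact: xs.
Qed.

Lemma word_setP k (w : k.-tuple (letter E)) :
  w \in word_set k <-> exists2 s, S s & w = prefix_of s k.
Proof.
rewrite inE; split=> [/asboolP [s Ss [j wE]]|[s Ss ->]].
  pose s' : letter_seq E := fun i => s (j + i)%N.
  have Ss' : S s'.
    have -> : s' = iter j (@Defs.shift R E) s.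
      apply/funext; rewrite /s'; elim: (j) => [|j' IH] i //.
      by rewrite iterS /Defs.shift -IH addSnnS.
    by elim: (j) => //= j'; exact: symbolic_space_shift.
  exists s' => //; apply: eq_from_tnth => i; rewrite tnth_mktuple.
  rewrite (tnth_nth (s 0%N)) wE size_tuple nth_mkseq //.
apply/asboolP; exists s => //; exists 0%N; rewrite size_tuple.
apply: (@eq_from_nth _ (s 0%N)); rewrite ?size_mkseq ?size_tuple // => i ik.
by rewrite nth_mkseq // -[i]/(val (Ordinal ik)) -tnth_nth tnth_mktuple.
Qed.

Definition truncate k (w : k.+1.-tuple (letter E)) : k.-tuple (letter E) :=
  [tuple tnth w (widen_ord (leqnSn k) i) | i < k].

Lemma truncate_prefix s k : truncate (prefix_of s k.+1) = prefix_of s k.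
Proof. by apply: eq_from_tnth => i; rewrite !tnth_mktuple. Qed.

Lemma truncate_words k : (@truncate k @: word_set k.+1 = word_set k)%SET.
Proof.
apply/setP => w; apply/imsetP/idP.
  move=> [w' /word_setP[s Ss ->] ->]; apply/word_setP; exists s => //.
  exact: truncate_prefix.
move=> /word_setP[s Ss ->]; exists (prefix_of s k.+1).
  by apply/word_setP; exists s.
by rewrite truncate_prefix.
Qed.

(** If there are not more words of length k + 1 than of length k, each word of
    length k has a single continuation, and then determines the whole sequence. *)
Lemma prefix_determines k : (complexity E k.+1 <= complexity E k)%N ->
  forall s s', S s -> S s' -> prefix_of s k = prefix_of s' k -> s = s'.
Proof.
rewrite /complexity -(truncate_words k) => le.
have /imset_injP inj : (#|(@truncate k @: word_set k.+1)%SET| == #|word_set k.+1|)%N.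
  by rewrite eqn_leq leq_imset_card le.
have next s s' : S s -> S s' -> prefix_of s k = prefix_of s' k ->
    prefix_of s k.+1 = prefix_of s' k.+1.
  move=> Ss Ss' e; apply: inj; [| |by rewrite !truncate_prefix].
    by apply/word_setP; exists s.
  by apply/word_setP; exists s'.
have coord s s' i : (i < k.+1)%N -> prefix_of s k.+1 = prefix_of s' k.+1 -> s i = s' i.
  move=> ik /(congr1 (fun w => tnth w (Ordinal ik))).
  by rewrite !tnth_mktuple.
have shiftE s s' : prefix_of s k.+1 = prefix_of s' k.+1 ->
    prefix_of (Defs.shift s) k = prefix_of (Defs.shift s') k.
  move=> e; apply: eq_from_tnth => i; rewrite !tnth_mktuple.
  by apply: coord e; rewrite ltnS.
move=> s s' Ss Ss' e; apply/funext => i.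
elim: i s s' Ss Ss' e => [|i IH] s s' Ss Ss' e; first exact: coord (next _ _ Ss Ss' e).
apply: (IH (Defs.shift s) (Defs.shift s')); try exact: symbolic_space_shift.
exact/shiftE/next.
Qed.

Lemma leb2_rectangle (A B : set (measurableTypeR R)) :
  measurable A -> measurable B ->
  leb2 R (A `*` B) = (lebesgue_measure A * lebesgue_measure B)%E.
Proof. exact: product_measure1E. Qed.

Lemma leb2_set1 (w : plane R) : (leb2 R).-negligible [set w].
Proof.
have -> : [set w] = [set w.1] `*` [set w.2].
  by case: w => x y; apply/seteqP; split => -[a b] /= => [[-> ->]|[-> ->]].
apply/negligibleP; first exact: measurableX.
apply: etrans (leb2_rectangle _ _) _ => //.
by rewrite lebesgue_measure_set1 mul0e.
Qed.

Lemma leb2_unit_square : leb2 R (`[0, 1[ `*` `[0, 1[) = 1%E.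
Proof.
apply: etrans (leb2_rectangle _ _) _ => //.
rewrite !lebesgue_measure_itv /= lte_fin ltr01.
by rewrite sube0 mule1.
Qed.

(** If it were so, the symbolic space would be finite, and the torus would be a
    finite set up to a null set. *)
Lemma prefix_not_determines k :
  ~ forall s s', S s -> S s' -> prefix_of s k = prefix_of s' k -> s = s'.
Proof.
move=> det.
have [_ [A' [B' [f [g [[_ A'S _ _] [_ _ [N [mN N0 sN]] _] [_ gA _ fg] _ _]]]]]] := cE.
pose F (j : nat) : set (plane R) := [set w | [/\ (`[0, 1[ `*` `[0, 1[) w, B' (pi w) &
  pickle (prefix_of (g (pi w)) k) = j]].
have F1 j w w' : F j w -> F j w' -> w = w'.
  move=> [Qw Bw wj] [Qw' Bw' wj'].
  have [_ _ i] := unit_square_fundamental R; apply: i => //; apply/pi_eq.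
  rewrite -(fg _ Bw) -(fg _ Bw'); congr f.
  apply: det; [exact/A'S/gA|exact/A'S/gA|].
  by apply: (pcan_inj pickleK); rewrite wj wj'.
have F0 j : (leb2 R).-negligible (F j).
  have [[w wF]|nF] := pselect (exists w, F j w).
    apply: negligibleS (leb2_set1 w) => w' w'F; exact: F1 w'F wF.
  rewrite (_ : F j = set0); first exact: negligible_set0.
  by apply/seteqP; split => // w wF; apply: nF; exists w.
pose Q : set (plane R) := `[0, 1[ `*` `[0, 1[.
have mQ : measurable Q by exact: measurableX.
have sub : Q `<=` (Q `&` (pi @^-1` N : set (plane R))) `|` \bigcup_j F j.
  move=> w Qw; have [Bw|nBw] := pselect (B' (pi w)).
    by right; exists (pickle (prefix_of (g (pi w)) k)).
  by left; split => //; apply: sN.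
have : (leb2 R).-negligible Q.
  apply: negligibleS sub _; apply: negligibleU; last exact: negligible_bigcup.
  exists (Q `&` (pi @^-1` N : set (plane R))); split => //.
  by apply: measurableI => //; exact: mN.
move=> /negligibleP => /(_ mQ) Q0.
have /eqP : (1 = 0 :> \bar R)%E := etrans (esym leb2_unit_square) Q0.
by rewrite onee_eq0.
Qed.

Lemma complexity_increases k : (complexity E k < complexity E k.+1)%N.
Proof.
by rewrite ltnNge; apply/negP => /prefix_determines; exact: prefix_not_determines.
Qed.

Lemma complexity_gap k j : (complexity E k + j <= complexity E (k + j))%N.
Proof.
elim: j => [|j IH]; first by rewrite !addn0.
by rewrite !addnS; apply: leq_ltn_trans IH _; exact: complexity_increases.
Qed.

Lemma complexity_ge k : (k < complexity E k)%N.
Proof.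
have := complexity_gap 0 k; rewrite add0n; apply: leq_trans.
rewrite -[X in (X <= _)%N]add1n leq_add2r lt0n cards_eq0; apply/eqP => L0.
apply: (@prefix_not_determines 0) => s s' Ss _ _.
have : prefix_of s 0 \in word_set 0 by apply/word_setP; exists s.
by rewrite L0 inE.
Qed.

End complexity_lower_bound.

Lemma golden_complexity_le (R : realType) n :
  (complexity (golden_exchange R n) (size (central n)).+1 <= (size (central n)).+2)%N.
Proof.
set N := (size (central n)).+1.
rewrite -(size_windows n) /complexity cardE.
set L := enum _.
have Linj : injective (fun w : N.-tuple (letter (golden_exchange R n)) =>
    map (@of_letter R n) w).
  by move=> w w' /(inj_map (can_inj (@of_letterK R n))) /val_inj.
rewrite -(size_map (fun w : N.-tuple _ => map (@of_letter R n) w)).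
apply: uniq_leq_size; first by rewrite (map_inj_uniq Linj) enum_uniq.
move=> _ /mapP[w + ->]; rewrite mem_enum.
move=> /(word_setP (golden_exchange_conjugate R n))[s [x tx /(codesP _ tx) ->] ->].
suff -> : map (@of_letter R n) (prefix_of (coding n x) N) = mkseq (tower_code n x) N.
  exact: code_windows.
rewrite -map_comp /mkseq -val_enum_ord -map_comp.
by apply: eq_map => i; rewrite /= to_letterK.
Qed.

(** The complexity exceeds k by at least 1 for each k and increases strictly, so
    that its value at one length bounds it at all smaller lengths. *)
Lemma golden_complexity (R : realType) n k : (k <= n)%N ->
  complexity (golden_exchange R n) k = k.+1.
Proof.
move=> kn; have cE := golden_exchange_conjugate R n.
apply/eqP; rewrite eqn_leq (complexity_ge cE) andbT.
have := complexity_gap cE k ((size (central n)).+1 - k).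
have kN : (k <= (size (central n)).+1)%N.
  by have := size_central n; have := size_block_ge n; have := size_block_gt0 n false; lia.
rewrite subnKC // => h; have := leq_trans h (golden_complexity_le R n).
by move: kN; lia.
Qed.

Theorem mainTheorem2 (R : realType) :
  (forall M : nat, exists E : exchange R,
     conjugate_to (@Tphi R) E /\
     forall k : nat, (1 <= k <= M)%N -> complexity E k = k.+1) /\
  (forall n : nat, map_complexity (@Tphi R) n = ((n.+1)%:R)%:E).
Proof.
split=> [M|n].
  exists (golden_exchange R M); split; first exact: golden_exchange_conjugate.
  by move=> k /andP[_ kM]; exact: golden_complexity.
apply/eqP; rewrite eq_le; apply/andP; split.
  apply: ereal_inf_lbound; exists (golden_exchange R n).
    exact: golden_exchange_conjugate.
  by rewrite golden_complexity.
apply/le_ereal_inf_tmp => _ [E cE <-].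
by rewrite lee_fin ler_nat; exact: complexity_ge.
Qed.
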